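(* Let $V\in L^{N/2}(\mathbb R^N)$ satisfy $\|V\|_{L^{N/2}}<S$ and $V(\tau x)=V(x)$. If $V(x)>0$ for almost every $x\in\mathbb R^N$, then $$\mu_V^\tau=\mu_0^\tau=2\mu_0,$$ and $\mu_V^\tau$ is not achieved, i.e. there is no $u\in\mathcal N_V^\tau$ with $E_V(u)=\mu_V^\tau$. Consequently the problem $$-\Delta u+V(x)u=f'(u)\ \text{ in }\mathbb R^N,\qquad E_V(u)<\infty,\qquad u(\tau x)=-u(x)$$ has no solution of minimal energy, i.e. no nontrivial solution $u$ with $E_V(u)=\mu_V^\tau$.
   Context: Let $N\ge 3$, $2^*=\frac{2N}{N-2}$, and let $\mathcal D^{1,2}=\mathcal D^{1,2}(\mathbb R^N)$ be the completion of $C_0^\infty(\mathbb R^N)$ with respect to the norm $\|u\|_{\mathcal D^{1,2}}=\left(\int_{\mathbb R^N}|\nabla u|^2dx\right)^{1/2}$. Put $$S:=\inf_{u\in\mathcal D^{1,2}\setminus\{0\}}\frac{\int_{\mathbb R^N}|\nabla u|^2}{\left(\int_{\mathbb R^N}|u|^{2^*}\right)^{2/2^*}}.$$ Assumptions on $f$: $f\in C^2(\mathbb R,\mathbb R)$ is even, $f(0)=f'(0)=0$, and - there exists $\mu>2$ such that $0<\mu f(s)\le f'(s)s<f''(s)s^2$ for all $s\ne0$; - there exist positive numbers $c_0,c_2,p,q$ with $2<p<2^*<q$ such that $c_0|s|^p\le f(s)$ for $|s|\ge1$, $c_0|s|^q\le f(s)$ for $|s|\le1$, $|f''(s)|\le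 c_2|s|^{p-2}$ for $|s|\ge1$, and $|f''(s)|\le c_2|s|^{q-2}$ for $|s|\le 1$. $\tau:\mathbb R^N\to\mathbb R^N$ is a fixed nontrivial orthogonal involution: a linear orthogonal map with $\tau\ne\mathrm{Id}$, $\tau^2=\mathrm{Id}$. It induces a linear isometry of $\mathcal D^{1,2}$, also denoted $\tau$, by $(\tau u)(x):=-u(\tau x)$, and $\mathcal D^{1,2}_\tau:=\{u\in\mathcal D^{1,2}:\tau u=u\}$ (the $\tau$-antisymmetric functions, $u(\tau x)=-u(x)$). For a potential $V\in L^{N/2}(\mathbb R^N)$ (including $V\equiv0$), for $u\in\mathcal D^{1,2}$, $$E_V(u)=\frac12\int_{\mathbb R^N}|\nabla u|^2dx+\frac12\int_{\mathbb R^N}V(x)u^2dx-\int_{\mathbb R^N}f(u)dx,$$ which is a $C^2$ functional on $\mathcal D^{1,2}$. Solutions are functions in $\mathcal D^{1,2}$ solving the equation weakly (critical points of $E_V$). The Nehari manifolds are $$\mathcal N_V=\Big\{u\in\mathcal D^{1,2}\setminus\{0\}:\int_{\mathbb R^N}|\nabla u|^2+Vu^2-f'(u)u\,dx=0\Big\},\qquad \mathcal N_V^\tau=\mathcal N_V\cap\mathcal D^{1,2}_\tau .$$ Set $\mu_0:=\inf_{\mathcal N_0}E_0$, $\mu_V^\tau:=\inf_{\mathcal N_V^\tau}E_V$, $\mu_0^\tau:=\inf_{\mathcal N_0^\tau}E_0$, where the subscript $0$ means $V\equiv0$. *)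

(* Defs.v *)
From HB Require Import structures.
From mathcomp Require Import all_boot all_order all_algebra.
From mathcomp Require Import all_classical all_reals all_analysis.

Set Implicit Arguments.
Unset Strict Implicit.
Unset Printing Implicit Defensive.
Import Order.TTheory GRing.Theory Num.Theory.
Import numFieldNormedType.Exports.

Local Open Scope classical_set_scope.
Local Open Scope ring_scope.

Definition rV_display : measure_display. Proof. exact. Qed.

Section measurable_rV.
Context {R : realType} {n : nat}.

Let coord (i : 'I_n) (x : 'rV[R]_n) : measurableTypeR R := x ord0 i.

Let rV_set0 : g_sigma_preimage coord set0.
Proof. exact: sigma_algebra0. Qed.

Let rV_setC A : g_sigma_preimage coord A -> g_sigma_preimage coord (~` A).
Proof. exact: sigma_algebraC. Qed.

Let rV_bigcup (F : (set 'rV[R]_n)^nat) : (forall i, g_sigma_preimage coord (F i)) ->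
  g_sigma_preimage coord (\bigcup_i (F i)).
Proof. exact: sigma_algebra_bigcup. Qed.

(* the product (= Borel) sigma-algebra of R^n *)
HB.instance Definition _ := @isMeasurable.Build rV_display
  'rV[R]_n (g_sigma_preimage coord) rV_set0 rV_setC rV_bigcup.

Lemma measurable_coord (i : 'I_n) :
  measurable_fun [set: 'rV[R]_n] (fun x => x ord0 i : measurableTypeR R).
Proof.
move=> _ Y mY; rewrite setTI; apply: sub_sigma_algebra => /=.
rewrite -bigcup_seq/=; exists i => /=; first by rewrite mem_index_enum.
by exists Y => //; rewrite setTI.
Qed.

Lemma measurable_fun_rVP d (T : measurableType d) (g : T -> 'rV[R]_n) :
  (forall i, measurable_fun setT (fun t => g t ord0 i : measurableTypeR R)) ->
  measurable_fun setT g.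
Proof.
move=> mg _ A mA; rewrite setTI.
suff : g_sigma_preimage coord `<=` [set B | measurable (g @^-1` B)] by exact.
apply: smallest_sub.
  split => [|B mB|F mF] /=.
  - by rewrite preimage_set0.
  - by rewrite setTD -preimage_setC; exact: measurableC.
  - by rewrite preimage_bigcup; apply: bigcup_measurable => k _; exact: mF.
rewrite -bigcup_seq => B [i _ [C mC <-]] /=.
by rewrite setTI -comp_preimage -[X in measurable X]setTI; exact: mg.
Qed.

End measurable_rV.

Section cons_rV.
Context {R : realType} {n : nat}.

Definition cons_rV (z : measurableTypeR R * 'rV[R]_n) : 'rV[R]_n.+1 :=
  \row_i oapp (z.2 ord0) z.1 (unlift ord0 i).

Definition uncons_rV (x : 'rV[R]_n.+1) : measurableTypeR R * 'rV[R]_n :=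
  (x ord0 ord0, \row_i x ord0 (lift ord0 i)).

Lemma uncons_rVK : cancel uncons_rV cons_rV.
Proof.
move=> x; apply/rowP => i; rewrite mxE.
by case: unliftP => [j ->|->] //=; rewrite mxE.
Qed.

Lemma cons_rVK : cancel cons_rV uncons_rV.
Proof.
case=> a v; rewrite /uncons_rV mxE unlift_none; congr pair.
by apply/rowP => i; rewrite !mxE liftK.
Qed.

Lemma measurable_cons_rV : measurable_fun setT cons_rV.
Proof.
apply: measurable_fun_rVP => i.
case: (unliftP ord0 i) => [j ->|->].
  under eq_fun do rewrite mxE liftK /=.
  exact: (measurableT_comp (measurable_coord j)).
under eq_fun do rewrite mxE unlift_none /=.
exact: measurable_fst.
Qed.

Lemma measurable_uncons_rV : measurable_fun setT uncons_rV.
Proof.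
apply/measurable_fun_pairP; split; first exact: measurable_coord.
apply: measurable_fun_rVP => i /=.
by under eq_fun do rewrite mxE; exact: measurable_coord.
Qed.

HB.instance Definition _ :=
  isMeasurableFun.Build _ _ _ _ cons_rV measurable_cons_rV.

End cons_rV.

Section lebesgue_succ.
Context {R : realType} {n : nat} (m : {sigma_finite_measure set 'rV[R]_n -> \bar R}).

Definition lebesgue_succ : set 'rV[R]_n.+1 -> \bar R :=
  pushforward (@lebesgue_measure R \x m)%E cons_rV.

Let lebesgue_succ0 : lebesgue_succ set0 = 0%E.
Proof. by rewrite /lebesgue_succ /pushforward preimage_set0 measure0. Qed.

Let lebesgue_succ_ge0 A : (0 <= lebesgue_succ A)%E.
Proof. exact: measure_ge0. Qed.

Let lebesgue_succ_sigma_additive : semi_sigma_additive lebesgue_succ.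
Proof.
exact: (@measure_semi_sigma_additive _ _ _
  [the measure _ _ of pushforward (@lebesgue_measure R \x m)%E cons_rV]).
Qed.

HB.instance Definition _ := isMeasure.Build _ _ _ lebesgue_succ
  lebesgue_succ0 lebesgue_succ_ge0 lebesgue_succ_sigma_additive.

Let lebesgue_succ_sigma_finite : sigma_finite setT lebesgue_succ.
Proof.
have /sigma_finiteP[F [TF ndF Foo]] := sigma_finiteT (@lebesgue_measure R).
have /sigma_finiteP[G [TG ndG Goo]] := sigma_finiteT m.
exists (fun k => uncons_rV @^-1` (F k `*` G k)).
  rewrite -preimage_bigcup -(preimage_setT uncons_rV); congr (_ @^-1` _).
  rewrite -setXTT TF TG predeqE => -[x y]; split.
    move=> [/= [k _ Fkx] [l _ Gly]]; exists (maxn k l) => //; split.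
    - by move: x Fkx; exact/subsetPset/ndF/leq_maxl.
    - by move: y Gly; exact/subsetPset/ndG/leq_maxr.
  by move=> [k _ []/= ? ?]; split; exists k.
move=> k; have [mF Fk] := Foo k; have [mG Gk] := Goo k; split.
  by rewrite -[X in measurable X]setTI; apply: measurable_uncons_rV => //;
    exact: measurableX.
rewrite /lebesgue_succ /pushforward -comp_preimage.
rewrite (_ : uncons_rV \o cons_rV = id); last first.
  by apply/funext => z /=; rewrite cons_rVK.
by rewrite preimage_id product_measure1E// lte_mul_pinfty// ge0_fin_numE.
Qed.

HB.instance Definition _ := Measure_isSigmaFinite.Build _ _ _ lebesgue_succ
  lebesgue_succ_sigma_finite.

End lebesgue_succ.

(* Lebesgue measure on R^n, as the n-fold product of the one on R *)
Fixpoint lebesgue_rV (R : realType) (n : nat) :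
    {sigma_finite_measure set 'rV[R]_n -> \bar R} :=
  match n with
  | 0 => \d_(0 : 'rV[R]_0)
  | k.+1 => lebesgue_succ (lebesgue_rV R k)
  end.

Section euclidean.
Context {R : realType} {N : nat}.
Implicit Types (x y : 'rV[R]_N) (phi : 'rV[R]_N -> R).

(* the norm `|x| of the library on 'rV[R]_N is the max norm *)
Definition dot x y : R := \sum_(i < N) x ord0 i * y ord0 i.

Definition partial (i : 'I_N) phi : 'rV[R]_N -> R :=
  fun x => 'D_(delta_mx ord0 i) phi x.

Definition gradient phi : 'rV[R]_N -> 'rV[R]_N :=
  fun x => \row_i partial i phi x.

(* C^k by iterated partial derivatives: differentiability is not assumed, but
   follows from the continuity of the partial derivatives. *)
Fixpoint is_Ck (k : nat) phi : Prop :=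
  match k with
  | 0 => continuous phi
  | k'.+1 => (forall i x, derivable phi x (delta_mx ord0 i)) /\
             (forall i, is_Ck k' (partial i phi))
  end.

Definition test_function phi : Prop :=
  (forall k, is_Ck k phi) /\ compact (closure [set x | phi x != 0]).

Definition orthogonal_map (tau : 'rV[R]_N -> 'rV[R]_N) : Prop :=
  forall x y, dot (tau x) (tau y) = dot x y.

End euclidean.

Section D12.
Context {R : realType}.
Local Open Scope ereal_scope.

Definition crit_exp (N : nat) : R := (2 * N%:R / (N%:R - 2))%R.

(* The completion of C_0^oo for the norm (\int |grad phi|^2)^(1/2), realized as
   a space of functions: by completeness of L^2 the gradients of a Cauchy
   sequence have a limit [Dgrad] in L^2, and by the Sobolev inequality the
   sequence itself has a limit [Dfun] in L^[crit_exp N]. Elements of the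
   completion are therefore these pairs up to almost everywhere equality, and
   [Dgrad] is the weak gradient of [Dfun]. *)
Record D12 (N : nat) := MkD12 {
  Dfun :> 'rV[R]_N -> R;
  Dgrad : 'rV[R]_N -> 'rV[R]_N;
  measurable_Dfun : measurable_fun setT Dfun;
  measurable_Dgrad : measurable_fun setT Dgrad;
  D12_approx : exists phi : nat -> 'rV[R]_N -> R,
    [/\ forall k, test_function (phi k),
        \int[lebesgue_rV R N]_x
          (dot (gradient (phi k) x - Dgrad x) (gradient (phi k) x - Dgrad x))%:E
          @[k --> \oo] --> 0 &
        \int[lebesgue_rV R N]_x (`|phi k x - Dfun x| `^ crit_exp N)%:E
          @[k --> \oo] --> 0]
}.

Context {N : nat}.
Implicit Types (u v : D12 N) (V : 'rV[R]_N -> R) (f : R -> R)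
  (tau : 'rV[R]_N -> 'rV[R]_N).
Local Notation mu := (lebesgue_rV R N).

Definition D12_zero u : Prop := {ae mu, forall x, u x = 0%R}.

(* u is a fixed point of the isometry (tau u)(x) := - u (tau x) *)
Definition tau_antisymmetric tau u : Prop :=
  {ae mu, forall x, u (tau x) = (- u x)%R}.

Definition sobolev_const : \bar R :=
  ereal_inf [set (\int[mu]_x (dot (Dgrad u x) (Dgrad u x))%:E)
                 / ((\int[mu]_x (`|u x| `^ crit_exp N)%:E) `^ (2 / crit_exp N))
            | u in [set u | ~ D12_zero u]].

Definition energy f V u : \bar R :=
  (1 / 2)%:E * \int[mu]_x (dot (Dgrad u x) (Dgrad u x))%:E
  + (1 / 2)%:E * \int[mu]_x (V x * u x ^+ 2)%:E
  - \int[mu]_x (f (u x))%:E.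

Definition nehari f V : set (D12 N) :=
  [set u | ~ D12_zero u /\
     \int[mu]_x (dot (Dgrad u x) (Dgrad u x) + V x * u x ^+ 2
                 - derive1 f (u x) * u x)%:E = 0].

Definition nehari_tau tau f V : set (D12 N) :=
  nehari f V `&` [set u | tau_antisymmetric tau u].

Definition nehari_level f V : \bar R :=
  ereal_inf [set energy f V u | u in nehari f V].

Definition nehari_level_tau tau f V : \bar R :=
  ereal_inf [set energy f V u | u in nehari_tau tau f V].

(* weak solutions of - Laplacian u + V u = f'(u), that is, critical points of
   [energy f V] *)
Definition weak_solution f V u : Prop := forall v : D12 N,
  \int[mu]_x (dot (Dgrad u x) (Dgrad v x) + V x * u x * v x
              - derive1 f (u x) * v x)%:E = 0.

End D12.
Arguments D12 R N : clear implicits.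
Arguments sobolev_const R N : clear implicits.

Section nonlinearity.
Context {R : realType}.
Implicit Types f : R -> R.

Definition C2 f : Prop :=
  [/\ forall s, derivable f s 1, forall s, derivable (derive1 f) s 1
    & continuous (derive1n 2 f)].

Definition superquadratic f : Prop :=
  exists mu : R, 2 < mu /\
    forall s, s != 0 ->
      [/\ 0 < mu * f s, mu * f s <= derive1 f s * s
        & derive1 f s * s < derive1n 2 f s * s ^+ 2].

Definition double_power_growth (N : nat) f : Prop :=
  exists c0 c2 p q : R,
    [/\ 0 < c0, 0 < c2, 2 < p, p < crit_exp N & crit_exp N < q] /\
    [/\ forall s, 1 <= `|s| -> c0 * `|s| `^ p <= f s,
        forall s, `|s| <= 1 -> c0 * `|s| `^ q <= f s,
        forall s, 1 <= `|s| -> `|derive1n 2 f s| <= c2 * `|s| `^ (p - 2)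
      & forall s, `|s| <= 1 -> `|derive1n 2 f s| <= c2 * `|s| `^ (q - 2)].

Definition admissible_nonlinearity (N : nat) f : Prop :=
  [/\ C2 f, forall s, f (- s) = f s, f 0 = 0 /\ derive1 f 0 = 0,
      superquadratic f & double_power_growth N f].

End nonlinearity.

(* Main.v *)
From HB Require Import structures.
Require Import Defs.
From mathcomp Require Import all_boot all_order all_algebra.
From mathcomp Require Import all_classical all_reals all_analysis.
From mathcomp Require Import measurable_realfun.
From mathcomp Require Import ring lra.

(** The three levels are compared by moving functions along their rays. For [u]
    in D12 and [Q > 0] the energy [t^2 Q / 2 - \int f (t u)] has a stationary
    point [t > 0] ([ray_deriv_solve]), and since [f'(s)/s] increases with [|s|]
    it is a maximum: a point of a Nehari manifold maximises the energy on its
    ray ([ray_energy_max]). With [Q = \int |grad u|^2 + V u^2], the stationary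
    points are the intersections of the ray with the Nehari manifold of [V].

    Three inequalities give the theorem.

    - Let [u] be antisymmetric on the Nehari manifold of [V]. The ray through [u]
      meets the Nehari manifold of the potential [0] at some [t u], and
      [E_0(t u) < E_V(t u) <= E_V(u)] because [V > 0]. Hence the level for [0] is
      at most the level for [V], and a minimiser for [V] would have an energy
      above the level for [0], which turns out to be the same
      ([nehari_tau_below]).

    - Let [u] be antisymmetric on the Nehari manifold of [0]. The positive parts
      [w] of [u] and [-u] are exchanged by [tau], so they carry half of every
      nonlinear integral, and one of them has at most half of the Dirichlet
      energy. Projecting that one on the Nehari manifold yields a point of energy
      at most [E_0(u) / 2], so the level for antisymmetric functions is at least
      twice the level without symmetry ([nehari_half]).

    - Let [u] be on the Nehari manifold of [0]. Take a test function [phi] close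
      to [u] and a vector [e] with [tau e = - e]. For large [n] the supports of
      [phi (x - n e)] and [phi (tau x - n e)] are disjoint and far away, where
      [V] contributes little, and their difference is antisymmetric. Its energy
      along its ray is almost twice that of [phi], whence [mu_V^tau <= 2 mu_0]
      ([nehari_above]).

    The bound on the norm of [V] enters through the positivity of the Sobolev
    constant, which prevents a nonzero element of D12 from having zero Dirichlet
    energy.

    The rest builds the required analysis. Lebesgue measure on R^n is invariant
    under translations and orthogonal involutions ([ge0_integral_rV_shift],
    [ge0_integral_rV_orth]). Test functions are stable under orthogonal affine
    changes of variables, and under composition with the primitive [softplus] of
    the logistic function, whose derivatives are polynomials in it. Passing to
    the limit twice puts the positive part of [u] in D12 with gradient
    [a grad u], where [a] takes its values between [0] and [1] ([D12_comp],
    [D12_pos]). *)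

Set Implicit Arguments.
Unset Strict Implicit.
Unset Printing Implicit Defensive.
Import Order.TTheory GRing.Theory Num.Theory.
Import numFieldNormedType.Exports.

Local Open Scope classical_set_scope.
Local Open Scope ring_scope.

(** * Borel functions on R^n *)

Section borel_rV.
Context {R : realType} {n : nat}.

Lemma measurable_dot d (T : measurableType d) (a b : T -> 'rV[R]_n) :
  measurable_fun setT a -> measurable_fun setT b ->
  measurable_fun setT (fun t => dot (a t) (b t) : measurableTypeR R).
Proof.
move=> ma mb; apply: measurable_sum => i.
apply: measurable_funM.
  exact: (measurableT_comp (measurable_coord i) ma).
exact: (measurableT_comp (measurable_coord i) mb).
Qed.

Lemma measurable_rV_add d (T : measurableType d) (a b : T -> 'rV[R]_n) :
  measurable_fun setT a -> measurable_fun setT b ->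
  measurable_fun setT (fun t => a t + b t).
Proof.
move=> ma mb; apply: measurable_fun_rVP => i.
under eq_fun do rewrite mxE.
apply: measurable_funD.
  exact: (measurableT_comp (measurable_coord i) ma).
exact: (measurableT_comp (measurable_coord i) mb).
Qed.

Lemma measurable_rV_scale d (T : measurableType d) (c : T -> R)
    (a : T -> 'rV[R]_n) :
  measurable_fun setT (c : T -> measurableTypeR R) -> measurable_fun setT a ->
  measurable_fun setT (fun t => c t *: a t).
Proof.
move=> mc ma; apply: measurable_fun_rVP => i.
under eq_fun do rewrite mxE.
apply: measurable_funM => //.
exact: (measurableT_comp (measurable_coord i) ma).
Qed.

Lemma linear_rVE (L : {linear 'rV[R]_n -> 'rV[R]_n}) x :
  L x = \sum_j x ord0 j *: L (delta_mx ord0 j).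
Proof.
by rewrite {1}(row_sum_delta x) linear_sum; apply: eq_bigr => j _; rewrite linearZ.
Qed.

Lemma measurable_linear_rV (L : {linear 'rV[R]_n -> 'rV[R]_n}) :
  measurable_fun setT L.
Proof.
apply: measurable_fun_rVP => i.
under eq_fun do rewrite linear_rVE summxE.
apply: measurable_sum => j.
under eq_fun do rewrite mxE.
by apply: measurable_funM => //; exact: measurable_coord.
Qed.

Definition grid (k : nat) (z : 'rV[int]_n) : 'rV[R]_n :=
  \row_i ((z ord0 i)%:~R / k.+1%:R).

Definition grid_floor (k : nat) (x : 'rV[R]_n) : 'rV[int]_n :=
  \row_i Num.floor (k.+1%:R * x ord0 i).

Lemma measurable_grid_floor k z : measurable [set x | grid_floor k x = z].
Proof.
rewrite [X in measurable X](_ : _ =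
  \bigcap_(i in [set: 'I_n]) ((fun x : 'rV[R]_n => x ord0 i) @^-1`
    `[(z ord0 i)%:~R / k.+1%:R, (z ord0 i + 1)%:~R / k.+1%:R[%classic)).
  apply: fin_bigcap_measurable => // i _.
  by rewrite -[X in measurable X]setTI; apply: measurable_coord => //;
    exact: measurable_itv.
apply/seteqP; split=> x /=.
  move=> <- i _ /=; rewrite mxE /= in_itv /= ler_pdivrMr// ltr_pdivlMr//.
  by rewrite mulrC; exact: floor_itv.
move=> H; apply/rowP => i; rewrite mxE; apply: floor_def.
have := H i I; rewrite /= in_itv /= ler_pdivrMr// ltr_pdivlMr//.
by rewrite mulrC.
Qed.

Lemma grid_cvg (x : 'rV[R]_n) : grid k (grid_floor k x) @[k --> \oo] --> x.
Proof.
apply/cvgrPdist_lt => e e0.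
near=> k; rewrite -[ltLHS]/(mx_norm _) (mx_normrE).
apply: bigmax_lt => // -[a i] _ /=; rewrite ord1 !mxE.
have k0 : (0 : R) < k.+1%:R by [].
have /andP[h1 h2] := floor_itv (k.+1%:R * x ord0 i).
rewrite (_ : _ - _ = (k.+1%:R * x ord0 i -
  (Num.floor (k.+1%:R * x ord0 i))%:~R) / k.+1%:R); last by field.
rewrite normrM normfV (gtr0_norm k0) ltr_pdivrMr// ger0_norm ?subr_ge0//.
rewrite ltrBlDl (lt_le_trans h2)// rmorphD /= lerD2l.
rewrite -ler_pdivrMl// mulr1 ltW//.
rewrite -(invrK (k.+1%:R)) ltf_pV2 ?posrE ?invr_gt0//.
near: k; exact: (near_infty_natSinv_lt (PosNum e0)).
Unshelve. all: by end_near. Qed.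

(** A continuous function is the limit of the step functions obtained by
    rounding its argument down to the grids of mesh [1/(k+1)]; these take
    countably many values, on measurable cells. *)
Lemma continuous_measurable_rV (g : 'rV[R]_n -> R) :
  continuous g -> measurable_fun setT g.
Proof.
move=> cg.
apply: (@measurable_fun_cvg _ _ _ _ (fun k x => g (grid k (grid_floor k x)))); last first.
  by move=> x _; apply: continuous_cvg; [exact: cg|exact: grid_cvg].
move=> k _ Y mY; rewrite setTI.
pose cell m := if unpickle m is Some z then
  (if g (grid k z) \in Y then [set x | grid_floor k x = z] else set0) else set0.
rewrite [X in measurable X](_ : _ = \bigcup_m cell m).
  apply: bigcup_measurable => m _; rewrite /cell.
  case: (unpickle m) => // z; case: ifPn => // _.
  exact: measurable_grid_floor.
apply/seteqP; split=> x /=.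
  move=> Yx; exists (pickle (grid_floor k x)) => //.
  by rewrite /cell pickleK ifT// inE.
move=> [m _]; rewrite /cell; case: (unpickle m) => // z; case: ifPn => // /set_mem gY.
by move=> /= ->.
Qed.

End borel_rV.

(** * Translation invariance of Lebesgue measure *)

Section lebesgue_rV_invariance.
Context {R : realType}.
Local Open Scope ereal_scope.

Lemma ge0_integral_lebesgue_shift (a : R) (F : R -> \bar R) :
  measurable_fun setT F -> (forall x, 0 <= F x) ->
  \int[lebesgue_measure]_x F (x + a)%R = \int[lebesgue_measure]_x F x.
Proof.
move=> mF F0.
pose sh : measurableTypeR R -> measurableTypeR R := fun x => (x + a)%R.
have ma : measurable_fun setT sh by apply: measurable_funD.
transitivity (\int[pushforward (@lebesgue_measure R) sh]_x F x).
  by rewrite ge0_integral_pushforward.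
apply: eq_measure_integral => A mA _; apply/esym.
have := @lebesgue_measure_unique R [the measure _ _ of pushforward (@lebesgue_measure R) sh].
apply => //.
move=> X [[c d] _ <-] /=; rewrite /pushforward.
rewrite [X in _ = lebesgue_measure X](_ : _ = `]c - a, d - a]%classic)%R; last first.
  apply/seteqP; split=> x /=; by rewrite !in_itv/= ltrBlDr lerBrDr.
rewrite !lebesgue_measure_itv/= !lte_fin ltrD2r.
by case: ifPn => // _; rewrite -!EFinB opprB addrA subrK.
Qed.

Lemma ge0_integral_lebesgue_rVS n (F : 'rV[R]_n.+1 -> \bar R) :
  measurable_fun setT F -> (forall x, 0 <= F x) ->
  \int[lebesgue_rV R n.+1]_x F x =
  \int[lebesgue_measure]_s \int[lebesgue_rV R n]_y F (cons_rV (s, y)).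
Proof.
move=> mF F0.
transitivity (\int[pushforward (@lebesgue_measure R \x lebesgue_rV R n) cons_rV]_x F x).
  exact: eq_measure_integral.
rewrite ge0_integral_pushforward//.
rewrite preimage_setT fubini_tonelli1//; last by move=> z; exact: F0.
by apply: measurableT_comp => //; exact: measurable_cons_rV.
Qed.

Lemma cons_rVD n (a : 'rV[R]_n.+1) s y :
  (cons_rV (s, y) + a = cons_rV (s + (uncons_rV a).1, y + (uncons_rV a).2))%R.
Proof.
apply/rowP => i; rewrite !mxE.
by case: unliftP => [j ->|->] //=; rewrite !mxE.
Qed.

Lemma ge0_integral_rV_shift n (a : 'rV[R]_n) (F : 'rV[R]_n -> \bar R) :
  measurable_fun setT F -> (forall x, 0 <= F x) ->
  \int[lebesgue_rV R n]_x F (x + a)%R = \int[lebesgue_rV R n]_x F x.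
Proof.
elim: n a F => [a F mF F0|n IH a F mF F0].
  by apply: eq_integral => x _; rewrite !(thinmx0 _).
have mshift (k : nat) (b : 'rV[R]_k) : measurable_fun setT (fun x : 'rV[R]_k => (x + b)%R).
  by apply: measurable_rV_add.
have mFa : measurable_fun setT (fun x : 'rV[R]_n.+1 => F (x + a)%R).
  exact: (measurableT_comp mF (mshift _ a)).
rewrite (ge0_integral_lebesgue_rVS mFa (fun x => F0 _)) (ge0_integral_lebesgue_rVS mF F0).
have mc : measurable_fun setT (F \o cons_rV).
  by apply: measurableT_comp => //; exact: measurable_cons_rV.
rewrite -[RHS](ge0_integral_lebesgue_shift (uncons_rV a).1); last 2 first.
- exact: (measurable_fun_fubini_tonelli_F (m2 := lebesgue_rV R n)
    (F \o cons_rV) mc (fun z => F0 _)).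
- by move=> s; exact: integral_ge0.
apply: eq_integral => s _.
under eq_integral do rewrite cons_rVD.
rewrite (IH _ (fun y => F (cons_rV ((s + (uncons_rV a).1)%R, y))))//.
exact: (measurableT_comp mc (pair1_measurable _)).
Qed.

Definition box n (M : R) : set 'rV[R]_n := [set x | forall i, `|x ord0 i| <= M]%R.

Lemma measurable_box n M : measurable (@box n M).
Proof.
rewrite (_ : box M = \bigcap_(i in [set: 'I_n])
   ((fun x : 'rV[R]_n => x ord0 i) @^-1` `[-M, M]%classic)%R).
  apply: fin_bigcap_measurable => // i _.
  by rewrite -[X in measurable X]setTI; apply: measurable_coord => //;
    exact: measurable_itv.
apply/seteqP; split => x /= H i; last first.
  by have := H i I; rewrite /= in_itv/= -ler_norml.
by move=> _; have := H i; rewrite /= in_itv/= -ler_norml.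
Qed.

Lemma lebesgue_rV_box n M : (0 < M)%R ->
  0 < lebesgue_rV R n (@box n M) < +oo.
Proof.
move=> M0; elim: n => [|n /andP[IH1 IH2]].
  rewrite /= diracE mem_set ?ltry ?lte_fin ?ltr01//.
  by move=> [].
rewrite /= /lebesgue_succ /pushforward.
rewrite (_ : _ @^-1` _ = `[-M, M]%classic `*` @box n M)%R; last first.
  apply/seteqP; split => -[s y] /=.
    move=> H; split.
      by have := H ord0; rewrite mxE unlift_none /= in_itv /= -ler_norml.
    by move=> i; have := H (lift ord0 i); rewrite mxE liftK.
  rewrite in_itv/= -ler_norml => -[h1 h2] i.
  by rewrite mxE; case: unliftP => [j _|_] /=; [exact: h2|exact: h1].
rewrite product_measure1E//; last exact: measurable_box.
have -> : (@lebesgue_measure R : {measure set _ -> \bar R}) `[(- M)%R, M]%classic = (M + M)%R%:E.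
  by rewrite -[LHS]/(lebesgue_measure _) lebesgue_measure_itv /= lte_fin ltrNl
    (lt_trans _ M0) ?oppr_lt0// -EFinB opprK.
rewrite mule_gt0// ?lte_fin; last by rewrite addr_gt0.
by rewrite lte_mul_pinfty// lee_fin addr_ge0// ltW.
Qed.

End lebesgue_rV_invariance.

(** * Invariance of Lebesgue measure under orthogonal involutions *)

Section orthogonal_invariance.
Context {R : realType} {n : nat}.
Local Notation mu := (lebesgue_rV R n).

Lemma dotDl (x y z : 'rV[R]_n) : dot (x + y) z = dot x z + dot y z.
Proof.
by rewrite /dot -big_split; apply: eq_bigr => i _; rewrite mxE mulrDl.
Qed.

Lemma dotC (x y : 'rV[R]_n) : dot x y = dot y x.
Proof. by apply: eq_bigr => i _; rewrite mulrC. Qed.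

Lemma dotDr (x y z : 'rV[R]_n) : dot x (y + z) = dot x y + dot x z.
Proof. by rewrite dotC dotDl !(dotC x). Qed.

Lemma dotZl a (x y : 'rV[R]_n) : dot (a *: x) y = a * dot x y.
Proof.
by rewrite /dot mulr_sumr; apply: eq_bigr => i _; rewrite mxE mulrA.
Qed.

Lemma dotZr a (x y : 'rV[R]_n) : dot x (a *: y) = a * dot x y.
Proof. by rewrite dotC dotZl dotC. Qed.

Lemma dotNl (x y : 'rV[R]_n) : dot (- x) y = - dot x y.
Proof. by rewrite -scaleN1r dotZl mulN1r. Qed.

Lemma dotNr (x y : 'rV[R]_n) : dot x (- y) = - dot x y.
Proof. by rewrite dotC dotNl dotC. Qed.

Lemma dot0l (x : 'rV[R]_n) : dot 0 x = 0.
Proof. by rewrite -(scale0r x) dotZl mul0r. Qed.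

Lemma dot_ge0 (x : 'rV[R]_n) : 0 <= dot x x.
Proof. by apply: sumr_ge0 => i _; rewrite -expr2 sqr_ge0. Qed.

Lemma sqr_coord_le_dot (x : 'rV[R]_n) i : x ord0 i ^+ 2 <= dot x x.
Proof.
rewrite /dot (bigD1 i)//= -expr2 lerDl.
by apply: sumr_ge0 => j _; rewrite -expr2 sqr_ge0.
Qed.

Lemma dot_eq0 (x : 'rV[R]_n) : dot x x = 0 -> x = 0.
Proof.
move=> h; apply/rowP => i; rewrite mxE; apply/eqP.
by rewrite -sqrf_eq0 eq_le sqr_ge0 andbT -h sqr_coord_le_dot.
Qed.

(** A set of positive finite measure that orthogonal maps preserve. *)
Definition unit_ball : set 'rV[R]_n := [set x | dot x x <= 1].

Lemma measurable_unit_ball : measurable unit_ball.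
Proof.
rewrite (_ : unit_ball = (fun x : 'rV[R]_n => dot x x) @^-1` `]-oo, 1]%classic).
  rewrite -[X in measurable X]setTI; apply: measurable_dot => //.
by apply/seteqP; split => x /=; rewrite /unit_ball/= in_itv.
Qed.

Lemma lebesgue_unit_ball : (0 < mu unit_ball < +oo)%E.
Proof.
have sub1 : unit_ball `<=` @box R n 1.
  move=> x Bx i; rewrite -(@expr_le1 _ 2)// real_normK ?num_real//.
  exact: le_trans (sqr_coord_le_dot _ _) Bx.
have n1 : 0 < n.+1%:R^-1 :> R by rewrite invr_gt0.
have sub2 : @box R n n.+1%:R^-1 `<=` unit_ball.
  move=> x Bx; rewrite /unit_ball /=.
  apply: (@le_trans _ _ (\sum_(i < n) n.+1%:R^-1)).
    apply: ler_sum => i _; rewrite -expr2 -real_normK ?num_real//.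
    rewrite (le_trans (_ : _ <= n.+1%:R^-1 ^+ 2))//.
      by rewrite lerXn2r ?nnegrE//.
    by rewrite exprS expr1 ger_pMl// invf_le1// ler1n.
  rewrite sumr_const card_ord -[X in X <= _]mulr_natl ler_pdivrMr// mul1r ler_nat.
  exact: leqnSn.
have /andP[h1 _] := @lebesgue_rV_box _ n _ n1.
have /andP[_ h2] := @lebesgue_rV_box _ n _ (@ltr01 R).
apply/andP; split.
  apply: lt_le_trans h1 _; apply: le_measure => //; rewrite inE.
    exact: measurable_box.
  exact: measurable_unit_ball.
apply: le_lt_trans h2; apply: le_measure => //; rewrite inE.
  exact: measurable_unit_ball.
exact: measurable_box.
Qed.

Let integral_orth_neg (L : {linear 'rV[R]_n -> 'rV[R]_n}) (F : 'rV[R]_n -> \bar R) :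
  orthogonal_map L -> involutive L ->
  measurable_fun setT F -> (forall x, 0 <= F x)%E ->
  (\int[mu]_x F (L x) = \int[mu]_x F (- x)%R)%E.
Proof.
move=> oL iL mF F0.
pose B x : \bar R := (\1_unit_ball x)%:E.
have mB : measurable_fun setT B.
  by apply/measurable_EFinP; apply: measurable_indic; exact: measurable_unit_ball.
have B0 x : (0 <= B x)%E by rewrite lee_fin.
have BL x : B (L x) = B x.
  by rewrite /B !indicE; congr ((nat_of_bool _)%:R%:E); apply/idP/idP;
    rewrite !inE /unit_ball /= oL.
have mL := measurable_linear_rV L.
have mN : measurable_fun setT (fun x : 'rV[R]_n => - x).
  under eq_fun do rewrite -scaleN1r.
  exact: measurable_rV_scale.
have IB : (\int[mu]_y B y)%E = mu unit_ball.
  by rewrite integral_indic// ?setIT//; exact: measurable_unit_ball.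
have /andP[B1 B2] := lebesgue_unit_ball.
have mFL : measurable_fun setT (F \o L) by exact: measurableT_comp.
have mFN : measurable_fun setT (fun x : 'rV[R]_n => F (- x)) by exact: (measurableT_comp mF mN).
have E1 : (\int[mu]_x \int[mu]_y (F (L x) * B (y + L x)%R) =
    (\int[mu]_x F (L x)) * mu unit_ball)%E.
  rewrite -ge0_integralZr//.
  apply: eq_integral => x _.
  rewrite (ge0_integral_rV_shift (L x) (F := fun y => (F (L x) * B y)%E)); last 2 first.
  - by apply: emeasurable_funM => //; exact: measurable_cst.
  - by move=> y; rewrite mule_ge0.
  by rewrite ge0_integralZl// IB.
have mxy : measurable_fun setT (fun z : 'rV[R]_n * 'rV[R]_n => z.2 + L z.1).
  by apply: measurable_rV_add => //; apply: measurableT_comp.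
have mxy' : measurable_fun setT (fun z : 'rV[R]_n * 'rV[R]_n => L z.1 + - z.2).
  apply: measurable_rV_add => //; first exact: measurableT_comp.
  exact: (measurableT_comp mN measurable_snd).
have E2 : (\int[mu]_x \int[mu]_y (F (L x) * B (y + L x)%R) =
   \int[mu]_y \int[mu]_x (F (L x) * B (y + L x)%R))%E.
  apply: (@fubini_tonelli _ _ _ _ _ mu mu
    (fun z => (F (L z.1) * B (z.2 + L z.1)%R)%E)).
    apply: emeasurable_funM.
      exact: (measurableT_comp mFL measurable_fst).
    exact: (measurableT_comp mB mxy).
  by move=> z; rewrite mule_ge0.
have E3 : (\int[mu]_y \int[mu]_x (F (L x) * B (y + L x)%R) =
   \int[mu]_y \int[mu]_x (F (L x + - y)%R * B x))%E.
  apply: eq_integral => y _.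
  rewrite -(ge0_integral_rV_shift (- L y)
    (F := fun x => (F (L x) * B (y + L x)%R)%E)); last 2 first.
  - apply: emeasurable_funM; first exact: mFL.
    apply: (measurableT_comp mB).
    by apply: measurable_rV_add; [exact: measurable_cst|exact: mL].
  - by move=> x; rewrite mule_ge0.
  by apply: eq_integral => x _; rewrite linearB iL addrCA subrr addr0 BL.
have E4 : (\int[mu]_x \int[mu]_y (F (L x + - y)%R * B x) =
   \int[mu]_y \int[mu]_x (F (L x + - y)%R * B x))%E.
  apply: (@fubini_tonelli _ _ _ _ _ mu mu
    (fun z => (F (L z.1 + - z.2)%R * B z.1)%E)).
    apply: emeasurable_funM.
      exact: (measurableT_comp mF mxy').
    exact: (measurableT_comp mB measurable_fst).
  by move=> z; rewrite mule_ge0.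
have E5 : (\int[mu]_x \int[mu]_y (F (L x + - y)%R * B x) =
  (\int[mu]_x F (- x)%R) * mu unit_ball)%E.
  set C := (\int[mu]_x F (- x)%R)%E.
  have C0 : (0 <= C)%E by apply: integral_ge0 => x _; exact: F0.
  transitivity (\int[mu]_x (C * B x))%E; last first.
    by rewrite (ge0_integralZl _ measurableT mB _ C0) ?IB// => x _; exact: B0.
  apply: eq_integral => x _.
  rewrite -(ge0_integral_rV_shift (L x) (F := fun y => (F (L x + - y)%R * B x)%E)); last 2 first.
  - apply: emeasurable_funM; last exact: measurable_cst.
    apply: (measurableT_comp mF).
    by apply: measurable_rV_add; [exact: measurable_cst|exact: mN].
  - by move=> y; rewrite mule_ge0.
  rewrite -(ge0_integralZr _ measurableT mFN _ (B0 x)); last by move=> y _; exact: F0.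
  by apply: eq_integral => y _; rewrite opprD addrCA subrr addr0.
have H : ((\int[mu]_x F (L x)) * mu unit_ball = (\int[mu]_x F (- x)%R) * mu unit_ball)%E.
  by rewrite -E1 E2 E3 -E4 E5.
have fB : mu unit_ball \is a fin_num by rewrite ge0_fin_numE// ltW.
by apply/eqP; rewrite eq_le; apply/andP; split; rewrite -(lee_pmul2r fB B1) H.
Qed.

(** Lebesgue measure is preserved by an orthogonal involution [L]. Translation
    invariance makes both [F \o L] and [F] integrate like the reflection
    [x |-> F (- x)]: integrate [F (L x) 1_B (y)] over both variables, with [B]
    the unit ball, translate [y] by [L x], then [x] by [- L y], then [y] by
    [L x] again, and find the integral of [F (- y) 1_B (x)]. *)
Lemma ge0_integral_rV_orth (L : {linear 'rV[R]_n -> 'rV[R]_n})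
    (F : 'rV[R]_n -> \bar R) :
  orthogonal_map L -> involutive L ->
  measurable_fun setT F -> (forall x, 0 <= F x)%E ->
  (\int[mu]_x F (L x) = \int[mu]_x F x)%E.
Proof.
move=> oL iL mF F0; rewrite integral_orth_neg//.
by rewrite -(@integral_orth_neg idfun).
Qed.

End orthogonal_invariance.

(** * Directional derivatives *)

Section directional_derivatives.
Context {R : realType} {n : nat}.
Implicit Types (phi : 'rV[R]_n -> R) (x v w : 'rV[R]_n).

Lemma is_derive_quotient phi x v (d : R) :
  (fun h : R => h^-1 * (phi (h *: v + x) - phi x)) @ 0^' --> d ->
  is_derive x v phi d.
Proof.
move=> H; apply: DeriveDef; first by apply/cvg_ex; exists d.
exact: cvg_lim.
Qed.

Lemma derive_quotient phi x v (d : R) : is_derive x v phi d ->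
  (fun h : R => h^-1 * (phi (h *: v + x) - phi x)) @ 0^' --> d.
Proof. by move=> [H <-]. Qed.

Lemma is_derive_line phi x v (s d : R) : is_derive (s *: v + x) v phi d ->
  is_derive s 1 (fun s : R => phi (s *: v + x)) d.
Proof.
move=> /derive_quotient H; apply: DeriveDef; last apply: cvg_lim => //.
  apply/cvg_ex; exists d.
  apply: cvg_trans H; apply: near_eq_cvg; near=> h => /=.
  by rewrite scaler1 scalerDl addrA.
apply: cvg_trans H; apply: near_eq_cvg; near=> h => /=.
by rewrite scaler1 scalerDl addrA.
Unshelve. all: by end_near. Qed.

Lemma is_derive_line0 phi x v (d : R) :
  is_derive (0 : R) 1 (fun s : R => phi (s *: v + x)) d -> is_derive x v phi d.
Proof.
move=> [H1 H2]; apply: is_derive_quotient; rewrite -H2.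
apply: cvg_trans H1; apply: near_eq_cvg; near=> h => /=.
by rewrite scaler1 addr0 scale0r add0r.
Unshelve. all: by end_near. Qed.

Lemma MVT_line phi (d : 'rV[R]_n -> R) x v (h : R) :
  (forall y, is_derive y v phi (d y)) ->
  exists2 th : R, `|th| <= `|h| & phi (h *: v + x) - phi x = h * d (th *: v + x).
Proof.
move=> D.
have L (s : R) : is_derive s 1 (fun s : R => phi (s *: v + x)) (d (s *: v + x)).
  exact: is_derive_line.
have C (a b : R) : {within `[a, b], continuous (fun s : R => phi (s *: v + x))}.
  apply: continuous_subspaceT => s.
  by apply: differentiable_continuous; apply/derivable1_diffP; case: (L s).
have [h0|h0] := leP 0 h.
  have [c] := MVT_segment h0 (fun s _ => L s) (@C _ _).
  rewrite in_itv /= => /andP[c0 ch]; rewrite scale0r add0r subr0 mulrC => ->.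
  by exists c => //; rewrite !ger0_norm.
have [c] := MVT_segment (ltW h0) (fun s _ => L s) (@C _ _).
rewrite in_itv /= => /andP[ch c0]; rewrite scale0r add0r sub0r => E.
exists c; first by rewrite !ler0_norm ?lerN2// ltW.
by rewrite -[LHS]opprB E mulrN opprK mulrC.
Qed.

Lemma is_derive_dirZ phi x v (c d : R) :
  is_derive x v phi d -> is_derive x (c *: v) phi (c * d).
Proof.
move=> D; apply: is_derive_line0.
have D0 : is_derive (c * 0 : R) 1 (fun s : R => phi (s *: v + x)) d.
  by apply: is_derive_line; rewrite mulr0 scale0r add0r.
have Dc : is_derive (0 : R) 1 (fun s : R => c * s) c.
  by apply: is_derive_eq; exact: mulr1.
rewrite (_ : (fun _ => _) = (fun s : R => phi (s *: v + x)) \o (fun s : R => c * s)).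
  by rewrite (mulrC c d); exact: is_derive1_comp.
by apply/funext => s /=; rewrite scalerA mulrC.
Qed.

(** Move first along [v], then along [w]. The mean value theorem expresses the
    second increment by a value of [d2] near [x]. *)
Lemma is_derive_dirD phi x v w (d1 : R) (d2 : 'rV[R]_n -> R) :
  is_derive x v phi d1 -> (forall y, is_derive y w phi (d2 y)) ->
  {for x, continuous d2} -> is_derive x (v + w) phi (d1 + d2 x).
Proof.
move=> D1 D2 cd2; apply: is_derive_quotient.
have /choice[th thP] : forall h : R, exists t : R, `|t| <= `|h| /\
    phi (h *: w + (h *: v + x)) - phi (h *: v + x) =
    h * d2 (t *: w + (h *: v + x)).
  by move=> h; have [t] := MVT_line (h *: v + x) h D2; exists t.
have C2 : (fun h : R => d2 (th h *: w + (h *: v + x))) @ 0^' --> d2 x.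
  apply: (@cvg_comp _ _ _ (fun h : R => th h *: w + (h *: v + x)) d2 0^'
    (nbhs x) (nbhs (d2 x)) _ cd2).
  have {2}-> : x = 0 *: w + (0 *: v + x) by rewrite !scale0r !add0r.
  have id0 : (fun h : R => h) @ 0^' --> (0 : R) by exact: cvg_within.
  apply: cvgD; last first.
    by apply: cvgD; [apply: cvgZr_tmp|exact: cvg_cst]; rewrite ?scale0r ?add0r.
  apply: cvgZr_tmp.
  apply/cvgr0Pnorm_lt => e e0.
  move/cvgr0Pnorm_lt : id0 => /(_ e e0); apply: filterS => h.
  by apply: le_lt_trans; case: (thP h).
have H := cvgD (derive_quotient D1) C2.
apply: cvg_trans (H _); apply: near_eq_cvg; near=> h.
have h0 : h != 0 by near: h; exact: nbhs_dnbhs_neq.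
rewrite /= fctE.
have [_ E] := thP h.
rewrite scalerDr (addrC (h *: v) (h *: w)) -(addrA (h *: w)) -[d2 _](mulKf h0) -E -mulrDr.
by congr (_ * _); ring.
Unshelve. all: by end_near. Qed.

End directional_derivatives.

(** * Smooth functions *)

Section smooth_functions.
Context {R : realType} {n : nat}.
Implicit Types (phi psi : 'rV[R]_n -> R) (x v w : 'rV[R]_n).

Definition smooth phi := forall k, is_Ck k phi.

Lemma smooth_continuous phi : smooth phi -> continuous phi.
Proof. by move=> /(_ 0%N). Qed.

Lemma smooth_is_derive phi i x : smooth phi ->
  is_derive x (delta_mx ord0 i) phi (partial i phi x).
Proof. by move=> /(_ 1%N) [H _]; apply: derivableP. Qed.

Lemma smooth_partial phi i : smooth phi -> smooth (partial i phi).
Proof. by move=> H k; have [_] := H k.+1; exact. Qed.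

(** Decompose [v] on the canonical basis and add the partial derivatives one
    at a time with [is_derive_dirD]. *)
Lemma smooth_derive_dir phi x v : smooth phi ->
  is_derive x v phi (dot v (gradient phi x)).
Proof.
move=> H; rewrite {1}(row_sum_delta v) /dot.
have E : (fun y => \sum_(j < n) v ord0 j * gradient phi y ord0 j) =
         (fun y => \sum_(j < n) v ord0 j * partial j phi y).
  by apply/funext => y; apply: eq_bigr => j _; rewrite mxE.
rewrite -[X in is_derive _ _ _ X]/((fun y => \sum_(j < n) v ord0 j * gradient phi y ord0 j) x).
rewrite E {E}; move: x.
elim: (index_enum _) => [x|j s IH x].
  by rewrite !big_nil; exact: is_derive0.
rewrite !big_cons [X in is_derive _ X _ _]addrC [X in is_derive _ _ _ X]addrC.
have D y : is_derive y (v ord0 j *: delta_mx ord0 j) phi (v ord0 j * partial j phi y).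
  by apply: is_derive_dirZ; exact: smooth_is_derive.
have C : {for x, continuous (fun y => v ord0 j * partial j phi y)}.
  exact: (@cvgMl_tmp R _ (nbhs x) _ (partial j phi) (v ord0 j) _
    (smooth_continuous (smooth_partial j H) (x:=x))).
exact: (is_derive_dirD (IH x) D C).
Qed.

Lemma is_CkD k phi psi : is_Ck k phi -> is_Ck k psi ->
  is_Ck k (fun x => phi x + psi x).
Proof.
elim: k phi psi => [|k IH] phi psi /=.
  by move=> c1 c2 x; exact: continuousD (c1 x) (c2 x).
move=> [d1 c1] [d2 c2]; split.
  by move=> i x; exact: derivableD.
move=> i; rewrite (_ : partial i _ = (fun x => partial i phi x + partial i psi x)).
  exact: IH.
by apply/funext => x; exact: deriveD.
Qed.

Lemma is_CkZ k (c : R) phi : is_Ck k phi -> is_Ck k (fun x => c * phi x).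
Proof.
elim: k phi => [|k IH] phi /=.
  by move=> c1 x; exact: (@cvgMl_tmp R _ (nbhs x) _ phi c _ (c1 x)).
move=> [d1 c1]; split.
  by move=> i x; exact: (@derivableZ _ _ _ phi c).
move=> i; rewrite (_ : partial i _ = (fun x => c * partial i phi x)).
  exact: IH.
by apply/funext => x; exact: (@deriveZ _ _ _ phi c).
Qed.

Lemma is_Ck0 k : is_Ck k (fun _ : 'rV[R]_n => 0 : R).
Proof.
elim: k => [|k IH] /=; first by move=> x; exact: cst_continuous.
split=> [i x|i]; first exact: derivable_cst.
rewrite (_ : partial i _ = fun=> 0)//.
by apply/funext => x; exact: derive_cst.
Qed.

Lemma is_Ck_sum k m (phi : 'I_m -> 'rV[R]_n -> R) :
  (forall j, is_Ck k (phi j)) -> is_Ck k (fun x => \sum_(j < m) phi j x).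
Proof.
move=> H; elim: (index_enum _) => [|j s IH].
  by under [X in is_Ck k X]funext do rewrite big_nil; exact: is_Ck0.
by under [X in is_Ck k X]funext do rewrite big_cons; exact: is_CkD.
Qed.

Lemma partial_affine (L : {linear 'rV[R]_n -> 'rV[R]_n}) b phi i x : smooth phi ->
  is_derive x (delta_mx ord0 i) (fun x => phi (L x + b))
    (dot (L (delta_mx ord0 i)) (gradient phi (L x + b))).
Proof.
move=> H; apply: is_derive_line0.
have := smooth_derive_dir (L x + b) (L (delta_mx ord0 i)) H.
rewrite -{1}(add0r (L x + b)) -(scale0r (L (delta_mx ord0 i))).
move/is_derive_line.
by under eq_fun do rewrite addrA -linearZ -linearD.
Qed.

Lemma continuous_linear_rV (L : {linear 'rV[R]_n -> 'rV[R]_n}) : continuous L.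
Proof.
move=> x; rewrite (_ : (L : _ -> _) = (fun x => \sum_j x ord0 j *: L (delta_mx ord0 j))).
  elim: (index_enum _) => [|j s IH].
    by under [X in continuous_at _ X]funext do rewrite big_nil; exact: cst_continuous.
  under [X in continuous_at _ X]funext do rewrite big_cons.
  apply: (@continuousD _ _ _ (fun x => x ord0 j *: L (delta_mx ord0 j))) IH.
  have C := @coord_continuous R 1 n ord0 j x.
  exact: (@cvgZr_tmp R _ 'rV[R]_n (nbhs x) _ (fun M : 'rV[R]_n => M ord0 j)
    (x ord0 j) (L (delta_mx ord0 j)) C).
by apply/funext => y; exact: linear_rVE.
Qed.

Lemma smooth_affine (L : {linear 'rV[R]_n -> 'rV[R]_n}) b phi : smooth phi ->
  smooth (fun x => phi (L x + b)).
Proof.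
move=> H k; elim: k phi H => [|k IH] phi H /=.
  move=> x; have C : {for x, continuous (fun x => L x + b)}.
    exact: continuousD (@continuous_linear_rV L x) (@cst_continuous _ _ b x).
  exact: (continuous_comp C (smooth_continuous H (x:=_))).
split=> [i x|i]; first by case: (partial_affine L b i x H).
rewrite (_ : partial i _ = (fun x => \sum_(j < n)
   L (delta_mx ord0 i) ord0 j * partial j phi (L x + b))).
  by apply: is_Ck_sum => j; apply: is_CkZ; apply: IH; exact: smooth_partial.
apply/funext => x; rewrite [LHS](@derive_val _ _ _ _ _ _ _ (partial_affine L b i x H)).
by apply: eq_bigr => j _; rewrite mxE.
Qed.

Lemma smoothD phi psi : smooth phi -> smooth psi -> smooth (fun x => phi x + psi x).
Proof. by move=> H1 H2 k; apply: is_CkD. Qed.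

Lemma smoothM phi psi : smooth phi -> smooth psi -> smooth (fun x => phi x * psi x).
Proof.
move=> H1 H2 k; elim: k phi psi H1 H2 => [|k IH] phi psi H1 H2 /=.
  move=> x.
  exact: continuousM (smooth_continuous H1 (x:=x)) (smooth_continuous H2 (x:=x)).
have D i x : is_derive x (delta_mx ord0 i) (fun x => phi x * psi x)
    (phi x * partial i psi x + partial i phi x * psi x).
  apply: is_derive_eq (is_deriveM (smooth_is_derive i x H1) (smooth_is_derive i x H2)) _.
  by rewrite -![_ *: _]/(_ * _); ring.
split=> [i x|i]; first by case: (D i x).
rewrite (_ : partial i _ = (fun x =>
    phi x * partial i psi x + partial i phi x * psi x)); last first.
  by apply/funext => x; case: (D i x).
by apply: is_CkD; apply: IH => //; exact: smooth_partial.
Qed.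

Lemma smoothZ c phi : smooth phi -> smooth (fun x => c * phi x).
Proof. by move=> H k; apply: is_CkZ. Qed.

Lemma is_derive_chain (g : R -> R) phi x v (dg d : R) :
  is_derive (phi x) 1 g dg -> is_derive x v phi d ->
  is_derive x v (fun y => g (phi y)) (dg * d).
Proof.
move=> H1 H2; apply: is_derive_line0.
apply: (@is_derive1_comp _ g (fun s : R => phi (s *: v + x))).
  by rewrite scale0r add0r.
by apply: is_derive_line; rewrite scale0r add0r.
Qed.

(** If [s] solves the autonomous equation [s' = Q(s)] with [Q] a polynomial,
    then every derivative of [P(s(phi))] is a sum of terms of the same form
    times derivatives of [phi]. *)
Lemma smooth_comp_autonomous (s : R -> R) (Q : {poly R}) (P : {poly R}) phi psi :
  (forall t : R, is_derive t 1 s Q.[s t]) -> smooth phi -> smooth psi ->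
  smooth (fun x => P.[s (phi x)] * psi x).
Proof.
move=> ds sphi spsi k; elim: k P psi spsi => [|k IH] P psi spsi /=.
  move=> x.
  have Cs : {for phi x, continuous s}.
    by apply: differentiable_continuous; apply/derivable1_diffP; case: (ds (phi x)).
  have C1 := continuous_comp (smooth_continuous sphi (x:=x)) Cs.
  have C2 := continuous_comp C1 (@continuous_horner _ P _).
  exact: (continuousM C2 (smooth_continuous spsi (x:=x))).
have D i x : is_derive x (delta_mx ord0 i) (fun x => P.[s (phi x)] * psi x)
   ((P^`() * Q).[s (phi x)] * (partial i phi x * psi x)
    + P.[s (phi x)] * partial i psi x).
  have D1 : is_derive x (delta_mx ord0 i) (fun x => P.[s (phi x)])
     (P^`().[s (phi x)] * Q.[s (phi x)] * partial i phi x).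
    have Hp := is_derive_poly P (s (phi x)).
    exact: (is_derive_chain (is_derive1_comp Hp (ds _)) (smooth_is_derive i x sphi)).
  have D2 := smooth_is_derive i x spsi.
  apply: is_derive_eq (is_deriveM D1 D2) _.
  by rewrite -![_ *: _]/(_ * _) hornerM; ring.
split=> [i x|i]; first by case: (D i x).
rewrite (_ : partial i _ = (fun x =>
   (P^`() * Q).[s (phi x)] * (partial i phi x * psi x)
    + P.[s (phi x)] * partial i psi x)); last first.
  by apply/funext => x; case: (D i x).
apply: is_CkD; last by apply: IH; exact: smooth_partial.
by apply: IH; apply: smoothM => //; exact: smooth_partial.
Qed.

End smooth_functions.

(** * Test functions *)

Section test_functions.
Context {R : realType} {n : nat}.
Implicit Types (phi psi : 'rV[R]_n -> R) (x v w : 'rV[R]_n).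
Local Notation mu := (lebesgue_rV R n).

Lemma continuous_dot : continuous (fun x : 'rV[R]_n => dot x x).
Proof.
move=> x; rewrite /dot; elim: (index_enum _) => [|j s IH].
  by under [X in continuous_at _ X]funext do rewrite big_nil; exact: cst_continuous.
under [X in continuous_at _ X]funext do rewrite big_cons.
apply: (@continuousD _ _ _ (fun x => x ord0 j * x ord0 j)) IH.
have C := @coord_continuous R 1 n ord0 j x.
exact: (continuousM C C).
Qed.

(** Euclidean balls, indexed by the square of the radius: translations and
    orthogonal maps act on them more simply than on the balls of the max norm. *)
Definition dball (M : R) : set 'rV[R]_n := [set x | dot x x <= M].

Lemma dball_box M x : dball M x -> box (M + 1) x.
Proof.
move=> xM i; have M0 : 0 <= M by apply: le_trans xM; exact: dot_ge0.
rewrite -(@ler_pXn2r _ 2) ?nnegrE ?addr_ge0// real_normK ?num_real//.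
apply: (le_trans (sqr_coord_le_dot x i)); apply: (le_trans xM); nra.
Qed.

Lemma norm_le_box M x : 0 <= M -> box M x -> `|x| <= M.
Proof.
move=> M0 H; rewrite -[leLHS]/(mx_norm _) (mx_normrE).
by apply: bigmax_le => // -[a i] _ /=; rewrite ord1; exact: H.
Qed.

Lemma closed_dball M : closed (dball M).
Proof.
rewrite (_ : dball M = (fun x => dot x x) @^-1` [set t | t <= M]) //.
apply: closed_comp; last exact: closed_le.
by move=> x _; exact: continuous_dot.
Qed.

Lemma compact_dball M : compact (dball M).
Proof.
apply: bounded_closed_compact; last exact: closed_dball.
exists (`|M| + 1); split; first exact: num_real.
move=> K /ltW MK x /dball_box xM.
apply: le_trans MK; apply: norm_le_box; first by rewrite addr_ge0.
by move=> i; apply: le_trans (xM i) _; rewrite lerD2r ler_norm.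
Qed.

Lemma measurable_dball M : measurable (dball M).
Proof.
rewrite (_ : dball M = (fun x : 'rV[R]_n => dot x x) @^-1` `]-oo, M]%classic).
  by rewrite -[X in measurable X]setTI; apply: measurable_dot => //.
by apply/seteqP; split => x /=; rewrite /dball/= in_itv.
Qed.

Lemma lebesgue_dball M : (mu (dball M) < +oo)%E.
Proof.
have M1 : 0 < `|M| + 1 :> R by apply: ltr_wpDl.
have /andP[_] := @lebesgue_rV_box _ n _ M1; apply: le_lt_trans.
apply: le_measure; rewrite ?inE; [exact: measurable_dball|exact: measurable_box|].
move=> x /dball_box xM i; apply: le_trans (xM i) _.
by rewrite lerD2r ler_norm.
Qed.

Lemma test_functionP phi : test_function phi <->
  smooth phi /\ exists M, forall x, phi x != 0 -> dball M x.
Proof.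
split=> [[s]|[s [M HM]]].
  move=> /compact_bounded [M [_ HM]]; split => //.
  exists (n%:R * (`|M| + 1) ^+ 2) => x x0.
  have : `|x| <= `|M| + 1.
    apply: HM; first by apply: le_lt_trans (ler_norm M) _; rewrite ltrDl.
    exact: subset_closure.
  move=> xM; rewrite /dball /= /dot mulr_natl -[X in _ *+ X]card_ord -sumr_const.
  apply: ler_sum => i _; rewrite -expr2 -real_normK ?num_real//.
  rewrite lerXn2r ?nnegrE ?addr_ge0//; apply: le_trans xM.
  rewrite -[leRHS]/(mx_norm _) mx_normrE.
  exact: (le_bigmax _ (fun i => `|x i.1 i.2|) (ord0, i)).
split=> //; apply: (subclosed_compact _ (@compact_dball M)).
  exact: closed_closure.
rewrite (iffLR (closure_id _) (@closed_dball M)).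
by apply: closure_subset => x; exact: HM.
Qed.

Lemma test_smooth phi : test_function phi -> smooth phi.
Proof. by case. Qed.

Lemma measurable_test phi : test_function phi -> measurable_fun setT phi.
Proof. by move=> /test_smooth/smooth_continuous; exact: continuous_measurable_rV. Qed.

(** The complement of the closed ball is open, so [phi] is zero near [x]. *)
Lemma gradient_out phi M x : (forall y, phi y != 0 -> dball M y) ->
  ~ dball M x -> gradient phi x = 0.
Proof.
move=> HM Mx; apply/rowP => i; rewrite !mxE /partial.
rewrite (_ : 0 = 'D_(delta_mx ord0 i) (cst 0 : _ -> R) x); last by rewrite derive_cst.
apply: near_eq_derive.
have : open (~` dball M) by apply: closed_openC; exact: closed_dball.
rewrite openE => /(_ x Mx); apply: filterS => y My.
by apply/eqP; apply: contra_notT My; exact: HM.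
Qed.

Lemma test_partial phi i : test_function phi -> test_function (partial i phi).
Proof.
move=> /test_functionP[s [M HM]]; apply/test_functionP; split.
  exact: smooth_partial.
exists M => x; apply: contra_neqP => Mx.
by have := gradient_out HM Mx => /rowP/(_ i); rewrite !mxE.
Qed.

Lemma test_bounded phi : test_function phi -> exists K, forall x, `|phi x| <= K.
Proof.
move=> /test_functionP[s [M HM]].
have : compact (phi @` dball M).
  apply: continuous_compact; last exact: compact_dball.
  by apply: continuous_subspaceT; exact: smooth_continuous.
move=> /compact_bounded [K [_ HK]]; exists (`|K| + 1) => x.
have [->|x0] := eqVneq (phi x) 0; first by rewrite normr0 addr_ge0.
apply: HK; first by apply: le_lt_trans (ler_norm K) _; rewrite ltrDl.
by exists x => //; exact: HM.
Qed.

Lemma testZ c phi : test_function phi -> test_function (fun x => c * phi x).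
Proof.
move=> /test_functionP[s [M HM]]; apply/test_functionP; split; first exact: smoothZ.
by exists M => x; rewrite mulf_eq0 negb_or => /andP[_]; exact: HM.
Qed.

Lemma testB phi psi : test_function phi -> test_function psi ->
  test_function (fun x => phi x - psi x).
Proof.
move=> /test_functionP[s1 [M1 HM1]] /test_functionP[s2 [M2 HM2]].
apply/test_functionP; split.
  under [X in smooth X]funext do rewrite -mulN1r.
  by apply: smoothD => //; exact: smoothZ.
exists (Num.max M1 M2) => x.
have [p1|/HM1 B1 _] := eqVneq (phi x) 0; last first.
  by rewrite /dball/= le_max; apply/orP; left.
rewrite p1 sub0r oppr_eq0 => /HM2 B2.
by rewrite /dball/= le_max; apply/orP; right.
Qed.

Lemma test_affine (L : {linear 'rV[R]_n -> 'rV[R]_n}) b phi :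
  orthogonal_map L -> test_function phi -> test_function (fun x => phi (L x + b)).
Proof.
move=> oL /test_functionP[s [M HM]]; apply/test_functionP; split.
  exact: smooth_affine.
exists (2 * M + 2 * dot b b) => x /HM; rewrite /dball /= => H.
rewrite -oL; set y := L x in H *.
have E : dot y y = 2 * dot (y + b) (y + b) + 2 * dot b b
    - dot (y + 2 *: b) (y + 2 *: b).
  rewrite !dotDl !dotDr !dotZl !dotZr (dotC b y); ring.
by have := dot_ge0 (y + 2 *: b); lra.
Qed.

(** The partial derivatives of [g (phi)] are those of [phi] times [s (phi)], to
    which [smooth_comp_autonomous] applies. *)
Lemma test_comp_autonomous (g s : R -> R) (Q : {poly R}) phi :
  (forall t : R, is_derive t 1 g (s t)) -> (forall t : R, is_derive t 1 s Q.[s t]) ->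
  g 0 = 0 -> test_function phi -> test_function (fun x => g (phi x)).
Proof.
move=> dg ds g0 /test_functionP[sphi [M HM]]; apply/test_functionP; split; last first.
  by exists M => x; apply: contra_neqP => Mx; rewrite (_ : phi x = 0)//;
    apply/eqP; apply: contra_notT Mx; exact: HM.
case=> [|k] /=.
  move=> x; have Cg : {for phi x, continuous g}.
    by apply: differentiable_continuous; apply/derivable1_diffP; case: (dg (phi x)).
  exact: (continuous_comp (smooth_continuous sphi (x:=x)) Cg).
have D i x := is_derive_chain (dg (phi x)) (smooth_is_derive i x sphi).
split=> [i x|i]; first by case: (D i x).
rewrite (_ : partial i _ = (fun x => ('X : {poly R}).[s (phi x)] * partial i phi x)).
  by apply: (smooth_comp_autonomous _ ds) => //; exact: smooth_partial.
by apply/funext => x; rewrite hornerX; case: (D i x).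
Qed.

Lemma gradient_comp (g s : R -> R) phi x :
  (forall t : R, is_derive t 1 g (s t)) -> smooth phi ->
  gradient (fun x => g (phi x)) x = s (phi x) *: gradient phi x.
Proof.
move=> dg sphi; apply/rowP => i; rewrite !mxE.
by case: (is_derive_chain (dg (phi x)) (smooth_is_derive i x sphi)).
Qed.

Lemma gradientB phi psi x : smooth phi -> smooth psi ->
  gradient (fun x => phi x - psi x) x = gradient phi x - gradient psi x.
Proof.
move=> s1 s2; apply/rowP => i; rewrite !mxE.
by case: (is_deriveB (smooth_is_derive i x s1) (smooth_is_derive i x s2)).
Qed.

Lemma gradientZ c phi x : smooth phi ->
  gradient (fun x => c * phi x) x = c *: gradient phi x.
Proof.
move=> s1; apply/rowP => i; rewrite !mxE.
by case: (is_deriveZ c (smooth_is_derive i x s1)).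
Qed.

(** For an orthogonal involution [L] is its own transpose. *)
Lemma gradient_affine (L : {linear 'rV[R]_n -> 'rV[R]_n}) b phi x :
  orthogonal_map L -> involutive L -> smooth phi ->
  gradient (fun x => phi (L x + b)) x = L (gradient phi (L x + b)).
Proof.
move=> oL iL s; apply/rowP => i; rewrite mxE /partial.
case: (partial_affine L b i x s) => _ ->.
rewrite -oL iL /dot (bigD1 i)//= !mxE !eqxx mul1r big1 ?addr0// => j ji.
by rewrite !mxE (negbTE ji) andbF mul0r.
Qed.

Lemma bounded_support_integrable (h : 'rV[R]_n -> R) K M : measurable_fun setT h ->
  (forall x, `|h x| <= K) -> (forall x, h x != 0 -> dball M x) ->
  mu.-integrable setT (EFin \o h).
Proof.
move=> mh hK hM; apply/integrableP; split; first exact/measurable_EFinP.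
apply: (@le_lt_trans _ _ (\int[mu]_x (K * \1_(dball M) x)%:E)%E).
  apply: ge0_le_integral => //.
  - by apply: measurableT_comp => //; exact/measurable_EFinP.
  - apply/measurable_EFinP; apply: measurable_funM => //.
    by apply: measurable_indic; exact: measurable_dball.
  - move=> x _; rewrite lee_fin /= indicE.
    have [->|/hM Mx] := eqVneq (h x) 0; last by rewrite mem_set// mulr1.
    by rewrite normr0 mulr_ge0// (le_trans _ (hK x)).
have K0 : 0 <= K by apply: le_trans (hK 0).
have mI : measurable_fun setT (fun x => (\1_(dball M) x : R)%:E).
  by apply/measurable_EFinP; apply: measurable_indic; exact: measurable_dball.
under eq_integral do rewrite EFinM.
rewrite (ge0_integralZl _ measurableT mI)//.
rewrite integral_indic//; last exact: measurable_dball.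
by rewrite setIT lte_mul_pinfty//; exact: lebesgue_dball.
Qed.

End test_functions.

(** * Growth and convexity of the nonlinearity *)

Section nonlinearity_estimates.
Context {R : realType}.

Lemma is_derive_continuous_within (g dg : R -> R) (a b : R) :
  (forall x, x \in `[a, b] -> is_derive x 1 g (dg x)) ->
  {within `[a, b], continuous g}.
Proof.
move=> D; apply: derivable_within_continuous => x xab.
by case: (D x xab).
Qed.

Lemma ge0_is_derive_le (g dg : R -> R) (a b : R) : a <= b ->
  (forall x, x \in `[a, b] -> is_derive x 1 g (dg x)) ->
  (forall x, x \in `[a, b] -> 0 <= dg x) -> g a <= g b.
Proof.
move=> ab D D0.
have D' x : x \in `]a, b[ -> is_derive x 1 g (dg x).
  by move=> xab; apply: D; exact: subset_itv_oo_cc.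
have [c cab E] := MVT_segment ab D' (is_derive_continuous_within D).
rewrite -subr_ge0 E mulr_ge0 ?subr_ge0//; exact: D0.
Qed.

Lemma is_derive_lipschitz (g dg : R -> R) (K M a b : R) :
  (forall x : R, is_derive x 1 g (dg x)) -> `|a| <= M -> `|b| <= M ->
  (forall x, `|x| <= M -> `|dg x| <= K) -> `|g a - g b| <= K * `|a - b|.
Proof.
move=> D; wlog ab : a b / a <= b.
  move=> H aM bM DK; have [|/ltW] := leP a b; first by move=> ?; exact: H.
  by move=> ?; rewrite distrC (distrC a); exact: H.
move=> aM bM DK.
have C : {within `[a, b], continuous g}.
  by apply: (@is_derive_continuous_within _ dg) => x _; exact: D.
have [c] := MVT_segment ab (fun x _ => D x) C; rewrite in_itv /= => /andP[ac cb] E.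
rewrite distrC (distrC a) E normrM ler_wpM2r//; apply: DK.
by move: aM bM; rewrite !ler_norml => /andP[? ?] /andP[? ?]; apply/andP; split; lra.
Qed.

Context (N : nat) (N2 : (2 < N)%N) (f : R -> R) (hf : admissible_nonlinearity N f).
Local Notation r := (@crit_exp R N).
Local Notation f1 := (derive1 f).
Local Notation f2 := (derive1n 2 f).

Lemma crit_exp_gt2 : 2 < r.
Proof.
have N2' : (2 : R) < N%:R by rewrite ltr_nat.
by rewrite /crit_exp ltr_pdivlMr; lra.
Qed.

Lemma is_derive_f (s : R) : is_derive s 1 f (f1 s).
Proof. by case: hf => -[d1 _ _] _ _ _ _; rewrite derive1E; exact: derivableP. Qed.

Lemma is_derive_f1 (s : R) : is_derive s 1 f1 (f2 s).
Proof.
case: hf => -[_ d2 _] _ _ _ _.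
by rewrite derive1nS derive1n1 derive1E; exact: derivableP.
Qed.

Lemma f_0 : f 0 = 0. Proof. by case: hf => _ _ []. Qed.
Lemma f1_0 : f1 0 = 0. Proof. by case: hf => _ _ []. Qed.
Lemma f_even s : f (- s) = f s. Proof. by case: hf. Qed.

Lemma f1_odd s : f1 (- s) = - f1 s.
Proof.
have H : is_derive s 1 (f \o -%R) (f1 (- s) * -1).
  exact: is_derive1_comp (is_derive_f (- s)) (is_deriveN (is_derive_id s 1)).
have E : f \o -%R = f by apply/funext => x; exact: f_even.
rewrite E in H; case: H => _ H1; case: (is_derive_f s) => _ H2.
by rewrite H1 mulrN1 in H2; rewrite -H2 opprK.
Qed.

Lemma continuous_f : continuous f.
Proof.
move=> s; apply: differentiable_continuous; apply/derivable1_diffP.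
by case: (is_derive_f s).
Qed.

Lemma continuous_f1 : continuous f1.
Proof.
move=> s; apply: differentiable_continuous; apply/derivable1_diffP.
by case: (is_derive_f1 s).
Qed.

Lemma f_gt0 s : s != 0 -> 0 < f s.
Proof.
case: hf => _ _ _ [mu [mu2 H]] _ s0; have [+ _ _] := H s s0.
by rewrite pmulr_rgt0//; lra.
Qed.

Lemma f_ge0 s : 0 <= f s.
Proof. by have [->|/f_gt0/ltW//] := eqVneq s 0; rewrite f_0. Qed.

Lemma f1M_ge0 s : 0 <= f1 s * s.
Proof.
case: hf => _ _ _ [mu [mu2 H]] _.
have [->|s0] := eqVneq s 0; first by rewrite mulr0.
by have [h1 h2 _] := H s s0; lra.
Qed.

(** The growth is supercritical near [0] and subcritical at infinity, hence
    bounded by the critical power everywhere. *)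
Lemma f2_bound : exists2 c, 0 < c & forall s, `|f2 s| <= c * `|s| `^ (r - 2).
Proof.
case: hf => _ _ _ _ [c0 [c2 [p [q [[_ c20 p2 pr rq] [_ _ H1 H2]]]]]].
have r2 := crit_exp_gt2.
exists c2 => // s; have [s1|/ltW s1] := leP 1 `|s|.
  by apply: le_trans (H1 _ s1) _; rewrite ler_pM2l// ler_powR//; lra.
apply: le_trans (H2 _ s1) _; rewrite ler_pM2l//.
have [->|s0] := eqVneq s 0.
  by rewrite normr0 !powR0//; apply/eqP; lra.
by apply: ger_powR; [rewrite normr_gt0 s0|lra].
Qed.

Lemma powRS (x e : R) : 0 <= x -> 0 < e -> x `^ (e + 1) = x `^ e * x.
Proof.
by move=> x0 e0; rewrite powRD ?powRr1// gt_eqF ?implyFb//; lra.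
Qed.

Lemma f_growth : exists2 c, 0 < c & forall M a b : R, `|a| <= M -> `|b| <= M ->
  `|f1 a - f1 b| <= c * M `^ (r - 2) * `|a - b| /\
  `|f a - f b| <= c * M `^ (r - 1) * `|a - b|.
Proof.
have r2 := crit_exp_gt2.
have [c c0 H] := f2_bound; exists c => //.
have F1 M a b : `|a| <= M -> `|b| <= M ->
    `|f1 a - f1 b| <= c * M `^ (r - 2) * `|a - b|.
  move=> aM bM; apply: is_derive_lipschitz aM bM _ => [|x xM].
    exact: is_derive_f1.
  apply: le_trans (H x) _; rewrite ler_pM2l// ge0_ler_powR ?nnegrE//; first by lra.
  exact: le_trans xM.
move=> M a b aM bM; split; first exact: F1.
apply: is_derive_lipschitz aM bM _ => [|x xM]; first exact: is_derive_f.
have M0 : 0 <= M by apply: le_trans xM.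
have := F1 M x 0 xM; rewrite normr0 f1_0 !subr0 => /(_ M0) h; apply: le_trans h _.
rewrite -mulrA ler_pM2l//.
rewrite [leRHS](_ : _ = M `^ (r - 2) * M); last first.
  by rewrite -powRS//; [congr (_ `^ _); ring|lra].
by rewrite ler_wpM2l// powR_ge0.
Qed.

(** Superquadraticity integrated along rays: [mu f(s) <= f'(s) s] says that
    [exp (- mu x) f (exp x s)] is nondecreasing in [x]. *)
Lemma f_ray : exists2 mu, 2 < mu &
  (forall s, mu * f s <= f1 s * s) /\
  (forall s x, 0 <= x -> expR (mu * x) * f s <= f (expR x * s)).
Proof.
case: hf => _ _ _ [mu [mu2 H]] _; exists mu => //.
have F s : mu * f s <= f1 s * s.
  have [->|s0] := eqVneq s 0; first by rewrite f_0 !mulr0.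
  by have [] := H s s0.
split=> // s x x0.
pose g (x : R) := expR (- (mu * x)) * f (expR x * s).
have D (y : R) : is_derive y 1 g
   (expR (- (mu * y)) * (f1 (expR y * s) * (expR y * s) - mu * f (expR y * s))).
  have D1 : is_derive y 1 (fun x : R => f (expR x * s)) (f1 (expR y * s) * (expR y * s)).
    apply: (@is_derive1_comp _ f (fun x => expR x * s)).
      exact: is_derive_f.
    apply: is_derive_eq; rewrite -![_ *: _]/(_ * _); ring.
  have D2 : is_derive y 1 (fun x : R => expR (- (mu * x))) (expR (- (mu * y)) * - mu).
    apply: (@is_derive1_comp _ expR (fun x => - (mu * x))).
    by apply: is_derive_eq; rewrite -![_ *: _]/(_ * _) mulr1.
  apply: is_derive_eq (is_deriveM D2 D1) _; rewrite -![_ *: _]/(_ * _); ring.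
have : g 0 <= g x.
  apply: (ge0_is_derive_le x0 (fun y _ => D y)) => y _.
  by rewrite mulr_ge0 ?expR_ge0// subr_ge0.
rewrite /g mulr0 oppr0 expR0 mul1r mul1r expRN ler_pdivlMl ?expR_gt0//.
Qed.

(** The derivative of [f'(ts)s / t] in [t] has the sign of
    [f''(ts) (ts)^2 - f'(ts) ts], which is nonnegative. *)
Lemma f1_ray_incr (s t u : R) : 0 < t -> t <= u ->
  u * (f1 (t * s) * s) <= t * (f1 (u * s) * s).
Proof.
move=> t0 tu.
have u0 : 0 < u by lra.
rewrite -ler_pdivlMl// mulrCA -ler_pdivrMl//.
pose g (x : R) := x^-1 * (f1 (x * s) * s).
suff : g t <= g u by [].
pose dg (x : R) := x^-1 ^+ 3 * (f2 (x * s) * (x * s) ^+ 2 - f1 (x * s) * (x * s)).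
apply: (@ge0_is_derive_le g dg) => // x; rewrite in_itv /= => /andP[tx _].
  have x0 : x != 0 by apply/eqP; lra.
  have D1 : is_derive x 1 (fun x : R => f1 (x * s)) (f2 (x * s) * s).
    apply: (@is_derive1_comp _ f1 (fun x => x * s)).
      exact: is_derive_f1.
    by apply: is_derive_eq; rewrite -![_ *: _]/(_ * _) mulr0 add0r mulr1.
  have D2 : is_derive x 1 (fun x : R => x^-1) (- x^-1 ^+ 2).
    apply: is_derive_eq (is_deriveV x0 (is_derive_id x 1)) _.
    by rewrite -![_ *: _]/(_ * _) mulr1 exprVn.
  have D3 := is_deriveM D1 (is_derive_cst s x 1).
  apply: is_derive_eq (is_deriveM D2 D3) _; rewrite -![_ *: _]/(_ * _) /dg.
  rewrite !fctE; field.
  done.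
have x0 : 0 < x by lra.
rewrite mulr_ge0 ?exprn_ge0 ?invr_ge0 ?(ltW x0)// subr_ge0.
case: hf => _ _ _ [mu [mu2 H]] _.
have [->|s0] := eqVneq s 0; first by rewrite !mulr0 expr0n mulr0.
by have [_ _ /ltW] := H (x * s) (mulf_neq0 (lt0r_neq0 x0) s0).
Qed.

(** Equivalently [t |-> t^2/2 f'(s)s - f(ts)] is largest at [t = 1]: its
    derivative [t f'(s)s - f'(ts)s] changes sign there by [f1_ray_incr]. *)
Lemma f_ray_max (s t : R) : 0 < t ->
  f s - f (t * s) <= (1 - t ^+ 2) / 2 * (f1 s * s).
Proof.
move=> t0.
pose k (x : R) := f (x * s) - x ^+ 2 / 2 * (f1 s * s).
pose dk (x : R) := f1 (x * s) * s - x * (f1 s * s).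
have D (x : R) : is_derive x 1 k (dk x).
  have D1 : is_derive x 1 (fun x : R => f (x * s)) (f1 (x * s) * s).
    apply: (@is_derive1_comp _ f (fun x => x * s)).
      exact: is_derive_f.
    by apply: is_derive_eq; rewrite -![_ *: _]/(_ * _) mulr0 add0r mulr1.
  have D2 : is_derive x 1 (fun x : R => x ^+ 2 / 2 * (f1 s * s)) (x * (f1 s * s)).
    by apply: is_derive_eq; rewrite -![_ *: _]/(_ * _); field.
  exact: is_derive_eq (is_deriveB D1 D2) _.
suff : k 1 <= k t by rewrite /k !mul1r expr1n; lra.
have [t1|/ltW t1] := leP 1 t.
  apply: (ge0_is_derive_le t1 (fun y _ => D y)) => x; rewrite in_itv/= => /andP[x1 _].
  have := @f1_ray_incr s 1 x ltr01 x1; rewrite !mul1r /dk; lra.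
have Dn (x : R) : is_derive x 1 (fun x => - k x) (- dk x) := is_deriveN (D x).
have : (fun x => - k x) t <= (fun x => - k x) 1.
  apply: (@ge0_is_derive_le (fun x => - k x) (fun x => - dk x)) => // x.
  rewrite in_itv/= => /andP[x1 x2]; rewrite /dk.
  have := @f1_ray_incr s x 1 (lt_le_trans t0 x1) x2; rewrite !mul1r; lra.
by rewrite /= lerN2.
Qed.

Lemma f1M_even s : f1 (- s) * - s = f1 s * s.
Proof. by rewrite f1_odd mulrNN. Qed.

End nonlinearity_estimates.

(** * The logistic function *)

Section logistic.
Context {R : realType}.

(** The logistic function is the derivative of a smooth approximation of the
    positive part. It solves [s' = K (s - s^2)], so its compositions with smooth
    functions are smooth by [smooth_comp_autonomous]. *)
Definition logistic (K t : R) : R := (1 + expR (- (K * t)))^-1.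

Definition softplus (K t : R) : R := (ln (1 + expR (K * t)) - ln 2) / K.

(** The limit of [logistic K] as [K] tends to infinity. The value [1/2] at [0]
    makes [heaviside t + heaviside (- t) = 1] hold for all [t]. *)
Definition heaviside (t : R) : R := if 0 < t then 1 else if t < 0 then 0 else 2^-1.

Lemma onePexp_gt0 (t : R) : 0 < 1 + expR t.
Proof. by rewrite addr_gt0 ?expR_gt0. Qed.

Lemma logistic_bounds K t : 0 <= logistic K t <= 1.
Proof.
have h := onePexp_gt0 (- (K * t)).
by rewrite /logistic invr_ge0 ltW//= invf_le1// lerDl expR_ge0.
Qed.

Lemma is_derive_expZ K (t : R) : is_derive t 1 (fun t => expR (K * t)) (K * expR (K * t)).
Proof.
rewrite mulrC; apply: (@is_derive1_comp _ expR (fun x => K * x)).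
by apply: is_derive_eq; rewrite -![_ *: _]/(_ * _) mulr1.
Qed.

Lemma is_derive_logistic K (t : R) :
  is_derive t 1 (logistic K) (K *: ('X - 'X^2)).[logistic K t].
Proof.
have h := onePexp_gt0 (- (K * t)).
have D0 : is_derive t 1 (fun t : R => expR (- (K * t))) (- K * expR (- (K * t))).
  have -> : (fun t : R => expR (- (K * t))) = (fun t => expR (- K * t)).
    by apply/funext => s; rewrite mulNr.
  by rewrite -mulNr; exact: is_derive_expZ.
have D1 := is_deriveD (is_derive_cst (1 : R) t 1) D0.
have D2 : is_derive t 1 (logistic K) _ :=
  @is_deriveV _ (fun t => 1 + expR (- (K * t))) t _ 1 (lt0r_neq0 h) D1.
apply: is_derive_eq D2 _.
rewrite -![_ *: _]/(_ * _) !hornerE /= ?add0r /logistic.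
set E := expR _; have hE : 1 + E != 0 by apply: lt0r_neq0.
by rewrite exprVn; field.
Qed.

Lemma is_derive_softplus K (t : R) : 0 < K ->
  is_derive t 1 (softplus K) (logistic K t).
Proof.
move=> K0; have h := onePexp_gt0 (K * t).
have D1 : is_derive t 1 (fun t : R => 1 + expR (K * t)) (K * expR (K * t)).
  by apply: is_derive_eq (is_deriveD (is_derive_cst (1 : R) t 1) (is_derive_expZ K t)) _;
    rewrite add0r.
have D2 : is_derive t 1 (fun t : R => ln (1 + expR (K * t)))
    ((1 + expR (K * t))^-1 * (K * expR (K * t))).
  exact: (@is_derive1_comp _ (@ln R) (fun t => 1 + expR (K * t)) t _ _ (is_derive1_ln h) D1).
have D3 : is_derive t 1 (softplus K) _ :=
  is_deriveM (is_deriveB D2 (is_derive_cst (ln 2 : R) t 1)) (is_derive_cst (K^-1) t 1).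
apply: is_derive_eq D3 _; rewrite -![_ *: _]/(_ * _) /logistic expRN.
have E0 := expR_gt0 (K * t).
set E := expR _ in h E0 *; rewrite !fctE /=.
have -> : (1 + E^-1)^-1 = E / (1 + E) by field; rewrite !lt0r_neq0//= addrC.
by field; rewrite !lt0r_neq0.
Qed.

Lemma softplus0 K : softplus K 0 = 0.
Proof. by rewrite /softplus mulr0 expR0 subrr mul0r. Qed.

Lemma softplus_lipschitz K a b : 0 < K -> `|softplus K a - softplus K b| <= `|a - b|.
Proof.
move=> K0; rewrite -[leRHS]mul1r.
apply: (is_derive_lipschitz (M := `|a| + `|b|) (fun t => is_derive_softplus t K0)).
- by rewrite lerDl.
- by rewrite lerDr.
by move=> x _; have /andP[? ?] := logistic_bounds K x; rewrite ger0_norm.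
Qed.

Lemma logistic_lipschitz K a b : 0 < K -> `|logistic K a - logistic K b| <= K * `|a - b|.
Proof.
move=> K0.
apply: (is_derive_lipschitz (M := `|a| + `|b|) (is_derive_logistic K)).
- by rewrite lerDl.
- by rewrite lerDr.
move=> x _; have /andP[? ?] := logistic_bounds K x.
rewrite !hornerE normrM gtr0_norm// ger_pMr//.
rewrite ger0_norm; nra.
Qed.

Lemma softplus_cvg K t : 0 < K -> `|softplus K t - Num.max t 0| <= ln 2 / K.
Proof.
move=> K0.
have l2 : 0 <= ln (2 : R) by rewrite ln_ge0// ler1n.
have [t0|t0] := leP t 0.
  rewrite subr0 ler0_norm; last first.
    rewrite -(softplus0 K); apply: (ge0_is_derive_le t0) => x _.
      exact: is_derive_softplus.
    by have /andP[] := logistic_bounds K x.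
  rewrite /softplus -mulNr ler_pM2r ?invr_gt0// opprB gerBl.
  by rewrite ln_ge0// lerDl expR_ge0.
have h1 : softplus K t <= t.
  have := @softplus_lipschitz K t 0 K0; rewrite softplus0 !subr0 (gtr0_norm t0).
  by apply: le_trans; exact: ler_norm.
rewrite ler0_norm ?subr_le0// opprB lerBlDr -lerBlDl.
rewrite /softplus ler_pdivlMr// mulrBl divfK ?lt0r_neq0// mulrC lerD2r.
by rewrite -[leLHS]expRK ler_ln ?posrE ?expR_gt0 ?onePexp_gt0// lerDr.
Qed.

Lemma heavisideN t : heaviside (- t) = 1 - heaviside t.
Proof.
rewrite /heaviside oppr_gt0 oppr_lt0; case: ltgtP => _; lra.
Qed.

Lemma heaviside_bounds t : 0 <= heaviside t <= 1.
Proof.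
rewrite /heaviside; case: ifP => _; first by rewrite ler01 lexx.
by case: ifP => _; rewrite ?lexx ?ler01 // invr_ge0 invf_le1 ?ler0n ?ler1n.
Qed.

Lemma logistic_cvg K t : 0 < K -> `|logistic K t - heaviside t| <= (K * `|t|)^-1.
Proof.
move=> K0; rewrite /heaviside /logistic.
have H (s : R) : 0 < s -> (1 + expR s)^-1 <= s^-1.
  move=> s0; rewrite lef_pV2 ?posrE ?onePexp_gt0//.
  by have := expR_ge1Dx s; lra.
have [t0|t0|<-] := ltgtP 0 t; last first.
- by rewrite mulr0 oppr0 expR0 subrr normr0 mulr0 invr0.
- rewrite subr0 ger0_norm ?invr_ge0 ?(ltW (onePexp_gt0 _))// ltr0_norm// mulrN.
  by apply: H; rewrite oppr_gt0 pmulr_rlt0.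
rewrite (gtr0_norm t0) expRN.
have E0 := expR_gt0 (K * t); set E := expR _ in E0 *.
have -> : (1 + E^-1)^-1 - 1 = - (1 + E)^-1.
  by field; rewrite ?lt0r_neq0 ?addr_gt0//= addrC.
rewrite normrN ger0_norm; last by rewrite invr_ge0 addr_ge0// ltW.
by apply: (H (K * t)); rewrite mulr_gt0.
Qed.

Lemma measurable_heaviside : measurable_fun setT heaviside.
Proof.
rewrite /heaviside; apply: measurable_fun_ifT => //.
  exact: measurable_fun_ltr.
apply: measurable_fun_ifT => //.
exact: measurable_fun_ltr.
Qed.

End logistic.

(** * Integrals of real functions *)

Section real_integrals.
Context {d} {T : measurableType d} {R : realType} (mu : {measure set T -> \bar R}).
Implicit Types (f g h : T -> R).

Definition intg h := mu.-integrable setT (EFin \o h).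
Local Notation J h := (Rintegral mu setT h).

Lemma intg_measurable h : intg h -> measurable_fun setT h.
Proof. by move=> /integrableP[/measurable_EFinP]. Qed.

Lemma integral_intg h : intg h -> (\int[mu]_x (h x)%:E)%E = (J h)%:E.
Proof. by move=> ih; rewrite /Rintegral fineK//; exact: integrable_fin_num. Qed.

Lemma intg_ge0 h : measurable_fun setT h -> (forall x, 0 <= h x) ->
  (\int[mu]_x (h x)%:E < +oo)%E -> intg h.
Proof.
move=> mh h0 hoo; apply/integrableP; split; first exact/measurable_EFinP.
by under eq_integral do rewrite /= ger0_norm//.
Qed.

Lemma intg_le f g : measurable_fun setT f -> (forall x, `|f x| <= g x) ->
  intg g -> intg f.
Proof.
move=> mf fg ig; apply: le_integrable ig => //; first exact/measurable_EFinP.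
by move=> x _; rewrite lee_fin (le_trans (fg x))// ler_norm.
Qed.

Lemma intgD f g : intg f -> intg g -> intg (fun x => f x + g x).
Proof. by move=> i1 i2; exact: (integrableD measurableT i1 i2). Qed.

Lemma intgB f g : intg f -> intg g -> intg (fun x => f x - g x).
Proof. by move=> i1 i2; exact: (integrableB measurableT i1 i2). Qed.

Lemma intgZ c f : intg f -> intg (fun x => c * f x).
Proof. by move=> i; exact: (integrableZl measurableT c i). Qed.

Lemma RintD f g : intg f -> intg g -> J (fun x => f x + g x) = J f + J g.
Proof. by move=> i1 i2; exact: (RintegralD measurableT i1 i2). Qed.

Lemma RintB f g : intg f -> intg g -> J (fun x => f x - g x) = J f - J g.
Proof. by move=> i1 i2; exact: (RintegralB measurableT i1 i2). Qed.

Lemma RintZ c f : intg f -> J (fun x => c * f x) = c * J f.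
Proof. by move=> i; exact: RintegralZl. Qed.

Lemma Rint_le f g : intg f -> intg g -> (forall x, f x <= g x) -> J f <= J g.
Proof. by move=> i1 i2 fg; apply: le_Rintegral. Qed.

Lemma Rint_ge0 f : (forall x, 0 <= f x) -> 0 <= J f.
Proof. by move=> f0; apply: Rintegral_ge0. Qed.

Lemma Rint_eq0 f : intg f -> (forall x, 0 <= f x) -> J f = 0 ->
  {ae mu, forall x, f x = 0}.
Proof.
move=> i f0 E.
have := (ae_eq_integral_abs mu measurableT (measurable_int mu i)).1.
rewrite (eq_integral (EFin \o f)); last by move=> x _ /=; rewrite ger0_norm.
rewrite integral_intg// E => /(_ erefl); apply: filterS => x /(_ I) /= [].
done.
Qed.

Lemma Rint_ae_eq f g : measurable_fun setT f -> measurable_fun setT g ->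
  {ae mu, forall x, f x = g x} -> J f = J g.
Proof.
move=> mf mg fg; congr fine; apply: ae_eq_integral => //.
- exact/measurable_EFinP.
- exact/measurable_EFinP.
- by apply: filterS fg => x + _ => ->.
Qed.

Lemma dominated_cvg0 (g_ : nat -> T -> R) h :
  (forall k, measurable_fun setT (g_ k)) -> intg h ->
  (forall k x, 0 <= g_ k x <= h x) -> (forall x, g_ k x @[k --> \oo] --> 0) ->
  forall e : R, 0 < e -> \forall k \near \oo, J (g_ k) < e.
Proof.
move=> mg ih gh g0 e e0.
have ig k : intg (g_ k).
  by apply: intg_le ih => // x; have /andP[? ?] := gh k x; rewrite ger0_norm.
have [] := @dominated_convergence _ _ _ mu setT measurableT
  (fun k x => (g_ k x)%:E) (cst 0%E) (EFin \o h).
- by move=> k; exact/measurable_EFinP.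
- exact: measurable_cst.
- by apply: aeW => x _; apply: cvg_EFin; [exact: nearW|exact: g0].
- exact: ih.
- apply: aeW => x k _ /=; rewrite lee_fin.
  by have /andP[? ?] := gh k x; rewrite ger0_norm.
move=> _ _ /=; rewrite integral0 => H.
have : (J (g_ k))%:E @[k --> \oo] --> (0%:E : \bar R).
  by under eq_fun do rewrite -integral_intg//.
move=> /fine_cvgP[_ /cvgr0Pnorm_lt/(_ e e0)]; apply: filterS => k /=.
by apply: le_lt_trans; exact: ler_norm.
Qed.

(** The functions [h 1_(k < h)] are dominated by [h] and tend to [0]. *)
Lemma intg_tail h (e : R) : intg h -> (forall x, 0 <= h x) -> 0 < e ->
  exists M : R, 0 < M /\ J (fun x => if M < h x then h x else 0) < e.
Proof.
move=> ih h0 e0.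
have mh := intg_measurable ih.
have [] := @dominated_cvg0 (fun k x => if k.+1%:R < h x then h x else 0) h _ ih _ _ _ e0.
- move=> k; apply: measurable_fun_ifT => //.
  exact: measurable_fun_ltr.
- by move=> k x; case: ifP; rewrite h0 lexx.
- move=> x; apply: cvg_near_cst.
  near=> k; rewrite ifF//; apply/negbTE; rewrite -leNgt.
  apply: (@le_trans _ _ k%:R); last by rewrite ler_nat.
  by near: k; exact: nbhs_infty_ger.
move=> K _ /(_ K (leqnn K)) /= HK.
by exists K.+1%:R.
Unshelve. all: by end_near. Qed.

End real_integrals.

(** * The closure of the test functions *)

Section D12_closure.
Context {R : realType} {N : nat} (N2 : (2 < N)%N).
Local Notation r := (@crit_exp R N).
Local Notation mu := (lebesgue_rV R N).
Local Notation J h := (Rintegral mu setT h).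
Implicit Types (phi u w : 'rV[R]_N -> R) (G H : 'rV[R]_N -> 'rV[R]_N).

Lemma powR_triangle (a b e : R) : 0 < e ->
  `|a + b| `^ e <= 2 `^ e * (`|a| `^ e + `|b| `^ e).
Proof.
move=> e0.
have mx0 : 0 <= Num.max `|a| `|b| by rewrite le_max normr_ge0.
apply: (@le_trans _ _ ((2 * Num.max `|a| `|b|) `^ e)).
  rewrite (ge0_ler_powR (ltW e0)) ?nnegrE ?mulr_ge0//.
  apply: le_trans (ler_normD _ _) _; rewrite mulr_natl mulr2n.
  by apply: lerD; rewrite le_max lexx ?orbT.
rewrite powRM// ler_pM2l ?powR_gt0//.
case: (leP `|a| `|b|) => _; first by rewrite lerDr powR_ge0.
by rewrite lerDl powR_ge0.
Qed.

Lemma dot_triangle (x y : 'rV[R]_N) : dot (x + y) (x + y) <= 2 * dot x x + 2 * dot y y.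
Proof.
have := dot_ge0 (x - y); rewrite !dotDl !dotDr !dotNl !dotNr (dotC y x); lra.
Qed.

Lemma measurable_norm_powR u e : measurable_fun setT u ->
  measurable_fun setT (fun x => `|u x| `^ e).
Proof.
move=> mh; apply: (measurableT_comp (measurable_powR e)).
exact: measurableT_comp.
Qed.

Lemma measurable_dotB G H : measurable_fun setT G -> measurable_fun setT H ->
  measurable_fun setT (fun x => dot (G x - H x) (G x - H x)).
Proof.
move=> mG mH.
have mGH : measurable_fun setT (fun x => G x - H x).
  apply: measurable_rV_add => //; under eq_fun do rewrite -scaleN1r.
  exact: measurable_rV_scale.
exact: measurable_dot.
Qed.

Lemma measurable_gradient phi : test_function phi -> measurable_fun setT (gradient phi).
Proof.
move=> tphi; apply: measurable_fun_rVP => i.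
under eq_fun do rewrite mxE.
exact: (measurable_test (test_partial i tphi)).
Qed.

Lemma crit_exp_gt0 : 0 < r.
Proof. by have := @crit_exp_gt2 R N N2; lra. Qed.

Lemma test_intg_powR phi (e : R) : 0 < e -> test_function phi ->
  intg mu (fun x => `|phi x| `^ e).
Proof.
move=> e0 tphi; have [K HK] := test_bounded tphi.
have [_ [M HM]] := (test_functionP _).1 tphi.
apply: (@bounded_support_integrable _ _ _ (K `^ e) M).
- by apply: measurable_norm_powR; exact: measurable_test.
- move=> x; rewrite ger0_norm ?powR_ge0// (ge0_ler_powR (ltW e0)) ?nnegrE//.
  exact: le_trans (HK x).
- move=> x; have [->|x0 _] := eqVneq (phi x) 0; last exact: HM.
  by rewrite normr0 powR0 ?eqxx// gt_eqF.
Qed.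

Lemma test_intg_grad phi : test_function phi ->
  intg mu (fun x => dot (gradient phi x) (gradient phi x)).
Proof.
move=> tphi.
have H i : intg mu (fun x => gradient phi x ord0 i * gradient phi x ord0 i).
  have tp := test_partial i tphi.
  have [K HK] := test_bounded tp.
  have [_ [M HM]] := (test_functionP _).1 tp.
  under [X in intg _ X]funext do rewrite mxE.
  apply: (@bounded_support_integrable _ _ _ (K * K) M).
  - by apply: measurable_funM; exact: measurable_test.
  - by move=> x; rewrite normrM ler_pM.
  - by move=> x; rewrite mulf_eq0 negb_or => /andP[+ _]; exact: HM.
rewrite /dot; elim: (index_enum _) => [|i s IH].
  under [X in intg _ X]funext do rewrite big_nil.
  exact: integrable0.
under [X in intg _ X]funext do rewrite big_cons.
exact: intgD.
Qed.

(** [(u, G)] lies in the closure of the pairs [(phi, gradient phi)], with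
    [phi] a test function, for the norms of [L^r] and [L^2]. *)
Definition in_closure u G := forall e : R, 0 < e -> exists phi,
  [/\ test_function phi,
      intg mu (fun x => dot (gradient phi x - G x) (gradient phi x - G x)),
      J (fun x => dot (gradient phi x - G x) (gradient phi x - G x)) < e,
      intg mu (fun x => `|phi x - u x| `^ r) &
      J (fun x => `|phi x - u x| `^ r) < e].

Lemma D12_in_closure (u : D12 R N) : in_closure u (Dgrad u).
Proof.
move=> e e0; have [phi [tphi c1 c2]] := D12_approx u.
have P (h : nat -> 'rV[R]_N -> R) : (forall k, measurable_fun setT (h k)) ->
    (forall k x, 0 <= h k x) -> (\int[mu]_x (h k x)%:E)%E @[k --> \oo] --> 0%E ->
    \forall k \near \oo, intg mu (h k) /\ J (h k) < e.
  move=> mh h0 /fine_cvgP[hfin /cvgr0Pnorm_lt/(_ e e0) hlt].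
  near=> k; split.
    apply: intg_ge0 => //; rewrite -ge0_fin_numE; last first.
      by apply: integral_ge0 => x _; rewrite lee_fin.
    by near: k.
  rewrite (le_lt_trans (ler_norm _))//; near: k; exact: hlt.
have n1 := P _ _ _ c1; have n2 := P _ _ _ c2.
have /filter_ex[k [[i1 j1] [i2 j2]]] : \forall k \near \oo,
   (intg mu (fun x => dot (gradient (phi k) x - Dgrad u x) (gradient (phi k) x - Dgrad u x)) /\
    J (fun x => dot (gradient (phi k) x - Dgrad u x) (gradient (phi k) x - Dgrad u x)) < e) /\
   (intg mu (fun x => `|phi k x - u x| `^ r) /\ J (fun x => `|phi k x - u x| `^ r) < e).
  near=> k; split.
    near: k; apply: n1 => [k|k x]; last exact: dot_ge0.
    apply: measurable_dotB; first exact: measurable_gradient.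
    exact: measurable_Dgrad.
  near: k; apply: n2 => [k|k x]; last exact: powR_ge0.
  apply: measurable_norm_powR; apply: measurable_funB; first exact: measurable_test.
  exact: measurable_Dfun.
by exists (phi k).
Unshelve. all: by end_near. Qed.

Lemma D12_of_closure u G : measurable_fun setT u -> measurable_fun setT G ->
  in_closure u G -> exists w : D12 R N, Dfun w = u /\ Dgrad w = G.
Proof.
move=> mu_ mG H.
have k0 (k : nat) : 0 < k.+1%:R^-1 :> R by rewrite invr_gt0.
have /choice[phi Hphi] := fun k => H _ (k0 k).
have C (h : nat -> 'rV[R]_N -> R) : (forall k x, 0 <= h k x) ->
    (forall k, intg mu (h k)) -> (forall k, J (h k) < k.+1%:R^-1) ->
    (\int[mu]_x (h k x)%:E)%E @[k --> \oo] --> 0%E.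
  move=> h0 ih jh; under eq_fun do rewrite integral_intg//.
  apply: cvg_EFin; first exact: nearW.
  apply: (@squeeze_cvgr _ _ _ _ (fun=> 0) (fun k => k.+1%:R^-1)).
  - by apply: nearW => k; rewrite Rint_ge0//= ltW.
  - exact: cvg_cst.
  - exact: cvg_harmonic.
have A : exists phi : nat -> 'rV[R]_N -> R,
    [/\ forall k, test_function (phi k),
      (\int[mu]_x (dot (gradient (phi k) x - G x) (gradient (phi k) x - G x))%:E)%E
        @[k --> \oo] --> 0%E &
      (\int[mu]_x (`|phi k x - u x| `^ r)%:E)%E @[k --> \oo] --> 0%E].
  exists phi; split.
  - by move=> k; case: (Hphi k).
  - apply: C => [k x|k|k]; [exact: dot_ge0|by case: (Hphi k)|by case: (Hphi k)].
  - apply: C => [k x|k|k]; [exact: powR_ge0|by case: (Hphi k)|by case: (Hphi k)].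
by exists (MkD12 mu_ mG A).
Qed.

Lemma D12_intg_powR (u : D12 R N) : intg mu (fun x => `|u x| `^ r).
Proof.
have [phi [tphi _ _ i1 _]] := @D12_in_closure u 1 ltr01.
have i2 := test_intg_powR crit_exp_gt0 tphi.
apply: (intg_le _ _ (intgZ (2 `^ r) (intgD i1 i2))).
  by apply: measurable_norm_powR; exact: measurable_Dfun.
move=> x; rewrite ger0_norm ?powR_ge0//.
rewrite -{1}(subrK (phi x) (u x)) (distrC (phi x)).
exact: powR_triangle crit_exp_gt0.
Qed.

Lemma D12_intg_grad (u : D12 R N) : intg mu (fun x => dot (Dgrad u x) (Dgrad u x)).
Proof.
have [phi [tphi i1 _ _ _]] := @D12_in_closure u 1 ltr01.
have i2 := test_intg_grad tphi.
apply: (intg_le _ _ (intgD (intgZ 2 i1) (intgZ 2 i2))).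
  by apply: measurable_dot; exact: measurable_Dgrad.
move=> x; rewrite ger0_norm ?dot_ge0//.
rewrite -{1 2}(subrK (gradient phi x) (Dgrad u x)).
apply: le_trans (dot_triangle _ _) _.
by rewrite -(opprB (gradient phi x)) dotNl dotNr opprK.
Qed.

Lemma in_closure_closed u G : measurable_fun setT u -> measurable_fun setT G ->
  (forall e : R, 0 < e -> exists w H,
    [/\ measurable_fun setT w /\ measurable_fun setT H, in_closure w H,
      intg mu (fun x => dot (H x - G x) (H x - G x)) /\
      J (fun x => dot (H x - G x) (H x - G x)) < e &
      intg mu (fun x => `|w x - u x| `^ r) /\
      J (fun x => `|w x - u x| `^ r) < e]) ->
  in_closure u G.
Proof.
move=> mu_ mG HC e e0.
have r0 := crit_exp_gt0.
have c0 : 0 < 2 `^ r :> R by rewrite powR_gt0.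
pose e1 := Num.min (e / 4) (e / (2 * 2 `^ r)).
have e10 : 0 < e1 by rewrite lt_min !divr_gt0// mulr_gt0.
have [w [H [[mw mH] wH [iH jH] [iw jw]]]] := HC e1 e10.
have [phi [tphi i1 j1 i2 j2]] := wH e1 e10.
have e14 : e1 <= e / 4 by rewrite ge_min lexx.
have e1r : e1 * (2 * 2 `^ r) <= e by rewrite -ler_pdivlMr ?mulr_gt0// ge_min lexx orbT.
have ib1 := intgD (intgZ 2 i1) (intgZ 2 iH).
have ib2 := intgZ (2 `^ r) (intgD i2 iw).
have p1 x : dot (gradient phi x - G x) (gradient phi x - G x) <=
   2 * dot (gradient phi x - H x) (gradient phi x - H x) + 2 * dot (H x - G x) (H x - G x).
  by rewrite -{1 2}(subrKA (H x)); exact: dot_triangle.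
have p2 x : `|phi x - u x| `^ r <= 2 `^ r * (`|phi x - w x| `^ r + `|w x - u x| `^ r).
  by rewrite -{1}(subrKA (w x)); exact: powR_triangle.
have I1 : intg mu (fun x => dot (gradient phi x - G x) (gradient phi x - G x)).
  apply: intg_le ib1 => [|x]; last by rewrite ger0_norm ?dot_ge0.
  by apply: measurable_dotB => //; exact: measurable_gradient.
have I2 : intg mu (fun x => `|phi x - u x| `^ r).
  apply: intg_le ib2 => [|x]; last by rewrite ger0_norm ?powR_ge0.
  by apply: measurable_norm_powR; apply: measurable_funB => //; exact: measurable_test.
exists phi; split => //.
  apply: le_lt_trans (Rint_le I1 ib1 p1) _.
  rewrite (RintD (intgZ 2 i1) (intgZ 2 iH)) (RintZ 2 i1) (RintZ 2 iH).
  by move: jH j1 e14; clear; lra.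
apply: le_lt_trans (Rint_le I2 ib2 p2) _.
rewrite (RintZ _ (intgD i2 iw)) (RintD i2 iw).
apply: lt_le_trans e1r.
rewrite [ltRHS](_ : _ = 2 `^ r * (e1 + e1)); last by ring.
by rewrite (ltr_pM2l c0) (ltrD j2 jw).
Qed.

Lemma D12_test phi : test_function phi ->
  exists w : D12 R N, Dfun w = phi /\ Dgrad w = gradient phi.
Proof.
move=> tphi; apply: D12_of_closure.
- exact: measurable_test.
- exact: measurable_gradient.
move=> e e0; exists phi.
have E1 : (fun x => dot (gradient phi x - gradient phi x) (gradient phi x - gradient phi x))
    = fun=> 0 by apply/funext => x; rewrite subrr dot0l.
have E2 : (fun x => `|phi x - phi x| `^ r) = fun=> 0.
  by apply/funext => x; rewrite subrr normr0 powR0// gt_eqF// crit_exp_gt0.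
have I0 : intg mu (fun=> 0) by exact: integrable0.
have J0 : J (fun=> 0) = 0 by rewrite /Rintegral integral0.
by rewrite E1 E2 J0; split.
Qed.

Lemma D12_scale (c : R) (u : D12 R N) : exists w : D12 R N,
  Dfun w = (fun x => c * u x) /\ Dgrad w = (fun x => c *: Dgrad u x).
Proof.
apply: D12_of_closure.
- by apply: measurable_funM => //; exact: measurable_Dfun.
- by apply: measurable_rV_scale => //; exact: measurable_Dgrad.
move=> e e0.
have c1 : 0 < 1 + c ^+ 2 + `|c| `^ r.
  by rewrite ltr_pwDl ?powR_ge0// ltr_pwDl ?sqr_ge0.
have e1 : 0 < e / (1 + c ^+ 2 + `|c| `^ r) by rewrite divr_gt0.
have [phi [tphi i1 j1 i2 j2]] := @D12_in_closure u _ e1.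
have E1 : (fun x => dot (gradient (fun x => c * phi x) x - c *: Dgrad u x)
    (gradient (fun x => c * phi x) x - c *: Dgrad u x)) =
   (fun x => c ^+ 2 * dot (gradient phi x - Dgrad u x) (gradient phi x - Dgrad u x)).
  apply/funext => x; rewrite gradientZ; last exact: test_smooth.
  by rewrite -scalerBr dotZl dotZr mulrA expr2.
have E2 : (fun x => `|c * phi x - c * u x| `^ r) =
   (fun x => `|c| `^ r * `|phi x - u x| `^ r).
  by apply/funext => x; rewrite -mulrBr normrM powRM.
exists (fun x => c * phi x); rewrite E1 E2; split.
- exact: testZ.
- exact: intgZ.
- rewrite RintZ//; apply: (@le_lt_trans _ _ ((1 + c ^+ 2 + `|c| `^ r) *
     J (fun x => dot (gradient phi x - Dgrad u x) (gradient phi x - Dgrad u x)))).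
    apply: ler_wpM2r; first by apply: Rint_ge0 => x; exact: dot_ge0.
    by have := powR_ge0 `|c| r; lra.
  by rewrite -ltr_pdivlMl// mulrC.
- exact: intgZ.
- rewrite RintZ//; apply: (@le_lt_trans _ _ ((1 + c ^+ 2 + `|c| `^ r) *
     J (fun x => `|phi x - u x| `^ r))).
    apply: ler_wpM2r; first by apply: Rint_ge0 => x; exact: powR_ge0.
    by have := sqr_ge0 c; lra.
  by rewrite -ltr_pdivlMl// mulrC.
Qed.

End D12_closure.

(** * Chain rule and positive part in D12 *)

Section D12_positive_part.
Context {R : realType} {N : nat} (N2 : (2 < N)%N).
Local Notation r := (@crit_exp R N).
Local Notation mu := (lebesgue_rV R N).
Local Notation J h := (Rintegral mu setT h).

Let r0 : 0 < r := crit_exp_gt0 N2.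

Lemma measurable_comp_cont (g : R -> R) (u : 'rV[R]_N -> R) :
  continuous g -> measurable_fun setT u -> measurable_fun setT (fun x => g (u x)).
Proof.
by move=> cg mu_; apply: (measurableT_comp _ mu_); exact: continuous_measurable_fun.
Qed.

Let cont_derive (g s : R -> R) : (forall t : R, is_derive t 1 g (s t)) -> continuous g.
Proof.
move=> dg t; apply: differentiable_continuous; apply/derivable1_diffP.
by case: (dg t).
Qed.

(** Chain rule in D12 for [g] with [0 <= g' <= 1] and [g'] Lipschitz. With
    [d = phi - u] and [h = |Dgrad u|^2], the term [(g' phi - g' u)^2 h] is small
    in [L^1]: it is at most [delta^2 h] where [K |d| <= delta], and elsewhere at
    most [M (K |d| / delta)^r] plus the part of [h] above the level [M]. *)
Lemma D12_comp (g s : R -> R) (Q : {poly R}) (K : R) (u : D12 R N) :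
  (forall t : R, is_derive t 1 g (s t)) -> (forall t : R, is_derive t 1 s Q.[s t]) ->
  g 0 = 0 -> (forall t, 0 <= s t <= 1) -> 0 < K ->
  (forall a b, `|g a - g b| <= `|a - b|) ->
  (forall a b, `|s a - s b| <= K * `|a - b|) ->
  in_closure (fun x => g (u x)) (fun x => s (u x) *: Dgrad u x).
Proof.
move=> dg ds g0 s01 K0 gL sL e e0.
have mu_ := measurable_Dfun u; have mG := measurable_Dgrad u.
pose h x := dot (Dgrad u x) (Dgrad u x).
have h0 x : 0 <= h x by exact: dot_ge0.
have ih : intg mu h := D12_intg_grad u.
have Jh : 0 <= J h by exact: Rint_ge0.
pose eta := e / 16.
have eta0 : 0 < eta by rewrite divr_gt0.
(* [dd] is the square of [delta] *)
pose dd := eta / (1 + J h).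
have dd0 : 0 < dd by rewrite divr_gt0// ltr_pwDl.
have ddJ : dd * J h <= eta.
  by rewrite /dd mulrAC ler_pdivrMr ?ltr_pwDl// ler_pM2l//; lra.
have [M [M0 JM]] := intg_tail ih h0 eta0.
pose c := (K / Num.sqrt dd) `^ r.
have c0 : 0 <= c by exact: powR_ge0.
pose e1 := Num.min (Num.min eta e) (eta / (1 + M * c)).
have Mc : 0 < 1 + M * c by rewrite ltr_pwDl// mulr_ge0// ltW.
have e10 : 0 < e1 by rewrite !lt_min eta0 e0 divr_gt0.
have e1eta : e1 <= eta by rewrite !ge_min lexx.
have e1e : e1 <= e by rewrite !ge_min lexx orbT.
have e1M : M * c * e1 <= eta.
  have : e1 * (1 + M * c) <= eta by rewrite -ler_pdivlMr// !ge_min lexx !orbT.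
  by nra.
have [phi [tphi i1 j1 i2 j2]] := D12_in_closure u e10.
have sphi := test_smooth tphi.
exists (fun x => g (phi x)).
pose X x := dot (gradient (fun x => g (phi x)) x - s (u x) *: Dgrad u x)
                (gradient (fun x => g (phi x)) x - s (u x) *: Dgrad u x).
pose a x := dot (gradient phi x - Dgrad u x) (gradient phi x - Dgrad u x).
pose tau x := if M < h x then h x else 0.
have itau : intg mu tau.
  apply: intg_le ih => [|x].
    apply: measurable_fun_ifT => //.
      by apply: measurable_fun_ltr => //; exact: measurable_dot.
    exact: measurable_dot.
  by rewrite /tau; case: ifP; rewrite ?normr0// ger0_norm.
pose Y x := 2 * a x + (2 * (dd * h x) + (2 * (M * c * `|phi x - u x| `^ r) + 2 * tau x)).
have XY x : X x <= Y x.
  rewrite /X (gradient_comp _ dg sphi).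
  rewrite (_ : _ - _ = s (phi x) *: (gradient phi x - Dgrad u x)
    + (s (phi x) - s (u x)) *: Dgrad u x); last first.
    by rewrite scalerBr scalerBl addrA subrK.
  apply: le_trans (dot_triangle _ _) _; rewrite /Y !dotZl !dotZr.
  have /andP[s0 s1] := s01 (phi x); have /andP[s0' s1'] := s01 (u x).
  rewrite lerD//.
    rewrite ler_pM2l// mulrA -[leRHS]mul1r ler_wpM2r//; first exact: dot_ge0.
    by rewrite mulr_ile1.
  rewrite -!mulrDr ler_pM2l// mulrA -expr2 -/(h x).
  set D := (s (phi x) - s (u x)) ^+ 2.
  have D0 : 0 <= D by exact: sqr_ge0.
  have D1 : D <= 1 by rewrite /D; nra.
  have P0 : 0 <= `|phi x - u x| `^ r by exact: powR_ge0.
  have tau0 : 0 <= tau x by rewrite /tau; case: ifP.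
  have [Ddd|Ddd] := leP D dd.
    apply: (@le_trans _ _ (dd * h x)); first by rewrite ler_wpM2r.
    by rewrite lerDl addr_ge0// !mulr_ge0// ltW.
  have c1 : 1 <= c * `|phi x - u x| `^ r.
    have q0 : 0 <= K / Num.sqrt dd by rewrite divr_ge0 ?sqrtr_ge0// ltW.
    rewrite /c -powRM//; have E1 : 1 `^ r = 1 :> R by rewrite powR1.
    rewrite -[leLHS]E1 (ge0_ler_powR (ltW r0)) ?nnegrE ?(mulr_ge0 q0)//.
    rewrite mulrAC ler_pdivlMr ?sqrtr_gt0// mul1r.
    apply: le_trans (sL _ _).
    by rewrite -sqrtr_sqr ler_sqrt ?sqr_ge0// ltW.
  have hM : h x <= M + tau x.
    by rewrite /tau; case: ltP => [_|hM]; [rewrite lerDr ltW|rewrite addr0].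
  apply: (@le_trans _ _ (M + tau x)).
    by apply: le_trans hM; rewrite ler_piMl.
  have : M * 1 <= M * (c * `|phi x - u x| `^ r) by rewrite ler_pM2l.
  have : 0 <= dd * h x by rewrite mulr_ge0// ltW.
  by rewrite mulr1 mulrA; lra.
have i3 := intgZ 2 i1; have i4 := intgZ 2 (intgZ dd ih).
have i5 := intgZ 2 (intgZ (M * c) i2); have i6 := intgZ 2 itau.
have iY : intg mu Y by exact: intgD i3 (intgD i4 (intgD i5 i6)).
have tg : test_function (fun x => g (phi x)).
  exact: test_comp_autonomous dg ds g0 tphi.
have ms : measurable_fun setT (fun x => s (u x)).
  by apply: measurable_comp_cont => //; exact: cont_derive ds.
have iX : intg mu X.
  apply: intg_le iY => [|x]; last by rewrite ger0_norm// dot_ge0.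
  apply: measurable_dotB; first exact: measurable_gradient.
  exact: measurable_rV_scale.
have iZ : intg mu (fun x => `|g (phi x) - g (u x)| `^ r).
  apply: intg_le i2 => [|x].
    apply: measurable_norm_powR; apply: measurable_funB; first exact: measurable_test.
    by apply: measurable_comp_cont => //; exact: cont_derive dg.
  by rewrite ger0_norm ?powR_ge0// (ge0_ler_powR (ltW r0)) ?nnegrE.
split => //.
  apply: le_lt_trans (Rint_le iX iY XY) _.
  rewrite /Y RintD//; last by do 2 apply: intgD => //.
  rewrite RintD//; last exact: intgD.
  rewrite RintD// !RintZ//; last exact: intgZ.
    rewrite -/(a) in i1 j1 *.
    have : M * c * J (fun x => `|phi x - u x| `^ r) <= M * c * e1.
      by apply: ler_wpM2l; [apply: mulr_ge0 => //; exact: ltW|exact: ltW].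
    rewrite -/(h) /eta in ddJ e1eta e1M JM eta0 *.
    rewrite /tau; lra.
  exact: intgZ.
apply: le_lt_trans (lt_le_trans j2 e1e); apply: Rint_le => // x.
by rewrite (ge0_ler_powR (ltW r0)) ?nnegrE.
Qed.

(** Both norms of the difference with [softplus k u] tend to [0] by dominated
    convergence, since [|softplus k s| <= |s|] and [logistic] is bounded. *)
Lemma D12_pos (u : D12 R N) : exists w : D12 R N,
  Dfun w = (fun x => Num.max (u x) 0) /\
  Dgrad w = (fun x => heaviside (u x) *: Dgrad u x).
Proof.
have mu_ := measurable_Dfun u; have mG := measurable_Dgrad u.
have mp : measurable_fun setT (fun x => Num.max (u x) 0).
  exact: measurable_maxr.
have mH : measurable_fun setT (fun x => heaviside (u x)).
  exact: (measurableT_comp measurable_heaviside mu_).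
have mHG : measurable_fun setT (fun x => heaviside (u x) *: Dgrad u x).
  exact: measurable_rV_scale.
apply: D12_of_closure => //.
apply: in_closure_closed => // e e0.
pose w k x := softplus k.+1%:R (u x).
pose H k x := logistic k.+1%:R (u x) *: Dgrad u x.
have k0 (k : nat) : 0 < k.+1%:R :> R by [].
have mw k : measurable_fun setT (w k).
  apply: measurable_comp_cont => //.
  by apply: (@cont_derive _ (logistic k.+1%:R)) => t; exact: is_derive_softplus.
have mHk k : measurable_fun setT (H k).
  apply: measurable_rV_scale => //.
  apply: measurable_comp_cont => //.
  exact: (cont_derive (is_derive_logistic k.+1%:R)).
pose h x := dot (Dgrad u x) (Dgrad u x).
have ih : intg mu h := D12_intg_grad u.
have ir := intgZ (2 `^ r) (D12_intg_powR N2 u).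
have mdH k := measurable_dotB (mHk k) mHG.
have mdw k : measurable_fun setT (fun x => `|w k x - Num.max (u x) 0| `^ r).
  by apply: measurable_norm_powR; exact: measurable_funB.
have bH k x : 0 <= dot (H k x - heaviside (u x) *: Dgrad u x)
    (H k x - heaviside (u x) *: Dgrad u x) <= h x.
  rewrite dot_ge0 /= -scalerBl dotZl dotZr mulrA -expr2 ler_piMl ?dot_ge0//.
  have /andP[? ?] := logistic_bounds k.+1%:R (u x).
  have /andP[? ?] := heaviside_bounds (u x); nra.
have bw k x : 0 <= `|w k x - Num.max (u x) 0| `^ r <= 2 `^ r * `|u x| `^ r.
  rewrite powR_ge0 /= -powRM// (ge0_ler_powR (ltW r0)) ?nnegrE ?mulr_ge0//.
  apply: le_trans (ler_normB _ _) _; rewrite mulr_natl mulr2n lerD//.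
    by have := softplus_lipschitz (u x) 0 (k0 k); rewrite softplus0 !subr0.
  by case: (leP (u x) 0) => _; rewrite ?normr0.
have cH x : dot (H k x - heaviside (u x) *: Dgrad u x)
    (H k x - heaviside (u x) *: Dgrad u x) @[k --> \oo] --> 0.
  apply: (@squeeze_cvgr _ _ _ _ (fun=> 0) (fun k : nat => k.+1%:R^-1 * (`|u x|^-1 * h x))).
  - apply: nearW => k; rewrite dot_ge0 /= -scalerBl dotZl dotZr !mulrA ler_wpM2r ?dot_ge0//.
    rewrite -invfM; apply: le_trans (logistic_cvg (u x) (k0 k)).
    have /andP[? ?] := logistic_bounds k.+1%:R (u x).
    have /andP[? ?] := heaviside_bounds (u x).
    set y := _ - _; have y1 : `|y| <= 1 by rewrite ler_norml /y; apply/andP; split; lra.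
    by rewrite -expr2 -real_normK ?num_real// expr2 ler_piMl.
  - exact: cvg_cst.
  - rewrite -[X in _ --> X](mul0r (`|u x|^-1 * h x)).
    by apply: cvgMr_tmp; exact: cvg_harmonic.
have cw x : `|w k x - Num.max (u x) 0| `^ r @[k --> \oo] --> 0.
  apply: (@squeeze_cvgr _ _ _ _ (fun=> 0) (fun k : nat => ln 2 * k.+1%:R^-1)).
  - apply: nearW => k; rewrite powR_ge0 /=.
    have B := softplus_cvg (u x) (k0 k).
    apply: le_trans B.
    have l1 : ln 2 <= 1 :> R by have := @le_ln1Dx R 1; rewrite (_ : 1 + 1 = 2)//; apply; lra.
    have y1 : `|w k x - Num.max (u x) 0| <= 1.
      apply: le_trans (softplus_cvg (u x) (k0 k)) _.
      by rewrite ler_pdivrMr// mul1r (le_trans l1)// ler1n.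
    have [->|y0] := eqVneq (w k x - Num.max (u x) 0) 0.
      by rewrite normr0 powR0// gt_eqF.
    apply: ge1r_powR; first by rewrite normr_gt0 y0.
    by have := @crit_exp_gt2 R N N2; lra.
  - exact: cvg_cst.
  - rewrite -[X in _ --> X](mulr0 (ln 2)).
    by apply: cvgMl_tmp; exact: cvg_harmonic.
have n1 := dominated_cvg0 mdH ih bH cH e0.
have n2 := dominated_cvg0 mdw ir bw cw e0.
case: n1 => K1 _ n1; case: n2 => K2 _ n2; set k := maxn K1 K2.
have jH := n1 k (leq_maxl _ _); have jw := n2 k (leq_maxr _ _).
exists (w k), (H k); split => //.
- apply: (@D12_comp (softplus k.+1%:R) (logistic k.+1%:R) (k.+1%:R *: ('X - 'X^2)) k.+1%:R u).
  + by move=> t; exact: is_derive_softplus.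
  + exact: is_derive_logistic.
  + exact: softplus0.
  + exact: logistic_bounds.
  + exact: k0.
  + by move=> a b; exact: softplus_lipschitz.
  + by move=> a b; exact: logistic_lipschitz.
- split => //; apply: intg_le ih => // x.
  by have /andP[? ?] := bH k x; rewrite ger0_norm.
- split => //; apply: intg_le ir => // x.
  by have /andP[? ?] := bw k x; rewrite ger0_norm.
Qed.

End D12_positive_part.

(** * Nonlinear integrals along rays *)

Section rays.
Context {R : realType} {N : nat} (N2 : (2 < N)%N).
Context (f : R -> R) (hf : admissible_nonlinearity N f).
Local Notation r := (@crit_exp R N).
Local Notation mu := (lebesgue_rV R N).
Local Notation J h := (Rintegral mu setT h).
Local Notation f1 := (derive1 f).
Implicit Types (u : 'rV[R]_N -> R).

(** By [f_bounds], [f (u)] and [f'(t u) u] are integrable for such [u]. *)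
Definition crit_intg u := measurable_fun setT u /\ intg mu (fun x => `|u x| `^ r).

Lemma D12_crit_intg (u : D12 R N) : crit_intg u.
Proof. by split; [exact: measurable_Dfun|exact: D12_intg_powR]. Qed.

Lemma crit_intgZ t u : crit_intg u -> crit_intg (fun x => t * u x).
Proof.
move=> [m i]; split; first exact: measurable_funM.
rewrite (_ : (fun _ => _) = (fun x => `|t| `^ r * `|u x| `^ r)); first exact: intgZ.
by apply/funext => x; rewrite normrM powRM.
Qed.

Lemma f_bounds : exists2 c, 0 < c &
  (forall s, `|f s| <= c * `|s| `^ r) /\
  (forall T t t' s : R, `|t| <= T -> `|t'| <= T ->
     `|f1 (t * s) * s - f1 (t' * s) * s| <= c * T `^ (r - 2) * `|t - t'| * `|s| `^ r).
Proof.
have r2 : 2 < r := @crit_exp_gt2 R N N2.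
have [c c0 H] := f_growth N2 hf; exists c => //; split=> [s|T t t' s tT t'T].
  have s0 : `|0 : R| <= `|s| by rewrite normr0.
  have [_] := H `|s| s 0 (lexx _) s0.
  rewrite (f_0 hf) !subr0 => /le_trans; apply.
  have r1 : 0 < r - 1 by lra.
  by rewrite -mulrA -powRS// subrK.
have T0 : 0 <= T by apply: le_trans tT.
have tsT : `|t * s| <= T * `|s| by rewrite normrM ler_wpM2r.
have t'sT : `|t' * s| <= T * `|s| by rewrite normrM ler_wpM2r.
have [+ _] := H _ _ _ tsT t'sT.
rewrite -mulrBl -mulrBl !normrM powRM// => h.
apply: (le_trans (ler_wpM2r (normr_ge0 s) h)).
rewrite [leRHS](_ : _ = c * (T `^ (r - 2) * `|s| `^ (r - 2)) * (`|t - t'| * `|s|) * `|s|)//.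
have -> : `|s| `^ r = `|s| `^ (r - 2) * `|s| * `|s|.
  rewrite -(@powRS _ _ (r - 2))//; last by lra.
  by rewrite -powRS//; [congr (_ `^ _); ring|lra].
ring.
Qed.

Lemma intg_f u : crit_intg u -> intg mu (fun x => f (u x)).
Proof.
move=> [m i]; have [c _ [H _]] := f_bounds.
apply: intg_le (intgZ c i) => [|x]; last exact: H.
by apply: measurable_comp_cont => //; exact: continuous_f hf.
Qed.

Lemma intg_f1 u t : crit_intg u -> intg mu (fun x => f1 (t * u x) * u x).
Proof.
move=> [m i]; have [c _ [_ H]] := f_bounds.
apply: intg_le (intgZ (c * `|t| `^ (r - 2) * `|t|) i) => [|x].
  apply: measurable_funM => //.
  apply: measurable_comp_cont; last exact: measurable_funM.
  exact: continuous_f1 hf.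
have t0 : `|0 : R| <= `|t| by rewrite normr0.
by have := H `|t| t 0 (u x) (lexx _) t0; rewrite mul0r (f1_0 hf) mul0r !subr0.
Qed.

(** The derivative of [\int f (t u)] with respect to [t]. *)
Definition ray_deriv u t := J (fun x => f1 (t * u x) * u x).

Lemma ray_deriv_lipschitz u : crit_intg u ->
  exists2 C, 0 <= C & forall T t t' : R, `|t| <= T -> `|t'| <= T ->
    `|ray_deriv u t - ray_deriv u t'| <= C * T `^ (r - 2) * `|t - t'|.
Proof.
move=> iu; have [m i] := iu; have [c c0 [_ H]] := f_bounds.
have B0 : 0 <= J (fun x => `|u x| `^ r) by apply: Rint_ge0 => x; exact: powR_ge0.
exists (c * J (fun x => `|u x| `^ r)); first by rewrite mulr_ge0// ltW.
move=> T t t' tT t'T.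
have i1 := intg_f1 t iu; have i2 := intg_f1 t' iu.
rewrite /ray_deriv -RintB//.
have i3 := intgZ (c * T `^ (r - 2) * `|t - t'|) i.
rewrite [leRHS](_ : _ = J (fun x => c * T `^ (r - 2) * `|t - t'| * `|u x| `^ r)); last first.
  by rewrite RintZ//; ring.
apply: le_trans (le_normr_Rintegral measurableT (intgB i1 i2)) _.
apply: Rint_le => //; last by move=> x; exact: H.
exact: (integrable_norm (intgB i1 i2)).
Qed.

(** The equation [ray_deriv u t = t Q] selects the points of the ray through
    [u] at which [t^2 Q / 2 - \int f (t u)] is stationary. Near [0] the left
    side is [O(t^(r-1))] with [r > 2], thus smaller than [t Q], and the
    intermediate value theorem applies. *)
Lemma ray_deriv_solve u Q b : crit_intg u -> 0 < Q -> 0 < b ->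
  b * Q <= ray_deriv u b -> exists2 t, 0 < t <= b & ray_deriv u t = t * Q.
Proof.
move=> iu Q0 b0 bQ.
have r2 : 2 < r := @crit_exp_gt2 R N N2.
have [C C0 L] := ray_deriv_lipschitz iu.
pose a := Num.min b ((Q / (1 + C)) `^ (r - 2)^-1).
have QC : 0 < Q / (1 + C) by rewrite divr_gt0// ltr_pwDl.
have a0 : 0 < a by rewrite lt_min b0 powR_gt0.
have ab : a <= b by rewrite ge_min lexx.
have aQ : ray_deriv u a <= a * Q.
  have t0 : `|0 : R| <= a by rewrite normr0 ltW.
  have ta : `|a| <= a by rewrite gtr0_norm.
  have := L a a 0 ta t0; rewrite subr0 (gtr0_norm a0).
  have -> : ray_deriv u 0 = 0.
    rewrite /ray_deriv (_ : (fun _ => _) = fun=> 0); first by rewrite /Rintegral integral0.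
    by apply/funext => x; rewrite mul0r (f1_0 hf) mul0r.
  rewrite subr0 => h; apply: le_trans (ler_norm _) _; apply: (le_trans h).
  rewrite mulrC ler_pM2l//.
  have rr : 0 <= r - 2 by lra.
  have : a `^ (r - 2) <= Q / (1 + C).
    have r20 : r - 2 != 0 by apply/eqP; lra.
    have E : Q / (1 + C) = ((Q / (1 + C)) `^ (r - 2)^-1) `^ (r - 2).
      by rewrite -powRrM mulVf// powRr1// ltW.
    by rewrite [leRHS]E ge0_ler_powR// ?nnegrE ?powR_ge0 ?(ltW a0)// ge_min lexx orbT.
  rewrite ler_pdivlMr; last by rewrite ltr_pwDl.
  have : 0 <= a `^ (r - 2) by exact: powR_ge0.
  nra.
pose g t := ray_deriv u t - t * Q.
have cg : {within `[a, b], continuous g}.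
  apply: continuous_subspaceT => t; apply: continuousB; last first.
    exact: (@continuousM _ _ id (cst Q) t (@cvg_id _ _) (@cst_continuous _ _ Q t)).
  apply/cvgrPdist_lt => e e0.
  pose T := `|t| + 1.
  have K0 : 0 < 1 + C * T `^ (r - 2) by rewrite ltr_pwDl// mulr_ge0// powR_ge0.
  have Ke : 0 < (1 + C * T `^ (r - 2))^-1 * e by rewrite mulr_gt0// invr_gt0.
  have n1 : nbhs t (ball t 1) by exact: nbhsx_ballx.
  have n2 : nbhs t (ball t ((1 + C * T `^ (r - 2))^-1 * e)) by exact: nbhsx_ballx.
  apply: filterS2 n1 n2 => s; rewrite /ball/= => s1 s2.
  have sT : `|s| <= T.
    rewrite -(subrK t s) (le_trans (ler_normD _ _))// addrC lerD2l distrC.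
    exact: ltW.
  have tT : `|t| <= T by rewrite lerDl.
  apply: le_lt_trans (L T t s tT sT) _.
  apply: (@le_lt_trans _ _ ((1 + C * T `^ (r - 2)) * `|t - s|)).
    by apply: ler_wpM2r => //; rewrite lerDr.
  by rewrite -ltr_pdivlMl.
have [|t] := IVT (v := 0) ab cg.
  have ga : g a <= 0 by rewrite subr_le0.
  have gb : 0 <= g b by rewrite subr_ge0.
  by rewrite ge_min ga le_max gb orbT.
rewrite in_itv/= => /andP[ta tb] /eqP; rewrite subr_eq0 => /eqP E.
by exists t; rewrite ?(lt_le_trans a0 ta).
Qed.

(** [f_ray_max] integrated: the energy on the ray through a point of the Nehari
    manifold is largest at that point. *)
Lemma ray_energy_max u Q t : crit_intg u -> 0 < t -> ray_deriv u 1 = Q ->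
  t ^+ 2 / 2 * Q - J (fun x => f (t * u x)) <= Q / 2 - J (fun x => f (u x)).
Proof.
move=> iu t0 <-.
have i1 := intg_f iu; have i2 := intg_f (crit_intgZ t iu); have i3 := intg_f1 1 iu.
suff : J (fun x => f (u x)) - J (fun x => f (t * u x)) <=
    (1 - t ^+ 2) / 2 * ray_deriv u 1 by lra.
rewrite -RintB// /ray_deriv -RintZ//; apply: Rint_le; [exact: intgB|exact: intgZ|].
by move=> x; rewrite mul1r; exact: f_ray_max hf _ _ t0.
Qed.

(** As [m > 2], [ray_deriv f u] overtakes every linear function, at a place that
    depends only on a lower bound of [\int f (u)]. *)
Lemma ray_deriv_growth : exists2 m, 2 < m &
  forall u x, crit_intg u -> 0 <= x ->
    expR x * (m * expR ((m - 2) * x) * J (fun y => f (u y))) <= ray_deriv u (expR x).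
Proof.
have [m m2 [H1 H2]] := f_ray hf; exists m => // u x iu x0.
have i1 := intg_f iu; have i3 := intg_f1 (expR x) iu.
rewrite mulrA -RintZ//; apply: Rint_le => //; first exact: intgZ.
move=> y; set s := u y.
rewrite -(ler_pM2r (expR_gt0 x)).
have -> : expR x * (m * expR ((m - 2) * x)) * f s * expR x = m * (expR (m * x) * f s).
  have -> : expR (m * x) = expR x * expR x * expR ((m - 2) * x).
    by rewrite -!expRD; congr expR; ring.
  ring.
have h := H1 (expR x * s); have := H2 s x x0; rewrite (mulrC (expR x) s) in h *.
move=> h2; rewrite -mulrA; apply: le_trans h; rewrite ler_pM2l//; lra.
Qed.

Lemma Rint_f_gt0 u : crit_intg u -> ~ {ae mu, forall x, u x = 0} -> 0 < J (fun x => f (u x)).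
Proof.
move=> iu u0; have i1 := intg_f iu.
have J0 : 0 <= J (fun x => f (u x)) by apply: Rint_ge0 => x; exact: f_ge0 hf _.
rewrite lt_neqAle J0 andbT eq_sym; apply/eqP => E; apply: u0.
have := Rint_eq0 i1 (fun x => f_ge0 hf _) E; apply: filterS => x fx.
by apply/eqP; apply: contra_eqT fx => ux; rewrite gt_eqF//; exact: f_gt0 hf _ ux.
Qed.

End rays.

(** * Nehari manifolds and lower bounds *)

Section nehari_levels.
Context {R : realType} {N : nat} (N2 : (2 < N)%N).
Context (f : R -> R) (hf : admissible_nonlinearity N f).
Local Notation r := (@crit_exp R N).
Local Notation mu := (lebesgue_rV R N).
Local Notation J h := (Rintegral mu setT h).
Local Notation f1 := (derive1 f).
Implicit Types (u w : D12 R N) (V : 'rV[R]_N -> R).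

(** Young's inequality with exponents [N/2] and [N/(N-2)]. *)
Lemma potential_intg V u : V \in Lfun mu (N%:R / 2)%:E ->
  intg mu (fun x => V x * u x ^+ 2).
Proof.
move=> hV.
have N2' : (2 : R) < N%:R by rewrite ltr_nat.
have m1 : 1 <= N%:R / 2 :> R by lra.
have iV : intg mu (fun x => `|V x| `^ (N%:R / 2)) := Lfun_integrable m1 hV.
have mV : measurable_fun setT V by exact: (set_mem (sub_Lfun_mfun hV)).
pose q : R := N%:R / (N%:R - 2).
have q0 : 0 < q by rewrite divr_gt0//; lra.
have q1 : 1 <= q by rewrite ler_pdivlMr; lra.
apply: intg_le (intgD iV (D12_intg_powR N2 u)) => [|x].
  apply: measurable_funM => //; apply: measurable_funX; exact: measurable_Dfun.
have E : `|u x| `^ r = (u x ^+ 2) `^ q.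
  rewrite -real_normK ?num_real// -powR_mulrn// -powRrM /crit_exp /q.
  by congr (_ `^ _); rewrite mulrA.
rewrite normrM (ger0_norm (sqr_ge0 (u x))) E.
have m0 : 0 < N%:R / 2 :> R by lra.
have pq : (N%:R / 2)^-1 + q^-1 = 1 :> R.
  by rewrite /q; field; apply/andP; split; apply/eqP; lra.
apply: le_trans (conjugate_powR (normr_ge0 (V x)) (sqr_ge0 (u x)) m0 q0 pq) _.
by apply: lerD; rewrite ler_pdivrMr// ler_peMr// powR_ge0.
Qed.

Definition dirichlet u := J (fun x => dot (Dgrad u x) (Dgrad u x)).
Definition potential V u := J (fun x => V x * u x ^+ 2).

(** The Sobolev quotient of [u] would vanish together with its numerator. *)
Lemma dirichlet_gt0 u : (0 < sobolev_const R N)%E -> ~ D12_zero u -> 0 < dirichlet u.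
Proof.
move=> S0 u0.
have A0 : 0 <= dirichlet u by apply: Rint_ge0 => x; exact: dot_ge0.
rewrite lt_neqAle A0 andbT eq_sym; apply/eqP => E.
have : (sobolev_const R N <= 0)%E.
  apply: ereal_inf_lbound; exists u => //.
  by rewrite (integral_intg (D12_intg_grad u)) -/(dirichlet u) E mul0e.
by rewrite leNgt S0.
Qed.

Lemma energyE V u : intg mu (fun x => V x * u x ^+ 2) ->
  energy f V u = (dirichlet u / 2 + potential V u / 2 - J (fun x => f (u x)))%:E.
Proof.
move=> iV; rewrite /energy (integral_intg (D12_intg_grad u)) (integral_intg iV).
rewrite (integral_intg (intg_f N2 hf (D12_crit_intg N2 u))).
by rewrite -!EFinM -EFinD !mul1r !(mulrC 2^-1).
Qed.

Lemma nehariE V u : intg mu (fun x => V x * u x ^+ 2) ->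
  nehari f V u <->
  ~ D12_zero u /\ ray_deriv f u 1 = dirichlet u + potential V u.
Proof.
move=> iV; rewrite /nehari /=.
have i1 := D12_intg_grad u; have i2 := intg_f1 N2 hf 1 (D12_crit_intg N2 u).
have -> : (\int[mu]_x (dot (Dgrad u x) (Dgrad u x) + V x * u x ^+ 2
   - f1 (u x) * u x)%:E)%E = (dirichlet u + potential V u - ray_deriv f u 1)%:E.
  rewrite /dirichlet /potential /ray_deriv -RintD// -RintB//; last exact: intgD.
  rewrite -integral_intg; last by apply: intgB => //; exact: intgD.
  by apply: eq_integral => x _; rewrite mul1r.
split=> [[u0 [/eqP]]|[u0 E]]; first by rewrite subr_eq0 => /eqP E.
by split=> //; rewrite E subrr.
Qed.

Lemma intg_potential0 u : intg mu (fun x => (fun=> 0) x * u x ^+ 2).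
Proof. by under [X in intg _ X]funext do rewrite mul0r; exact: integrable0. Qed.

Lemma potential0 u : potential (fun=> 0) u = 0.
Proof.
rewrite /potential; under eq_Rintegral do rewrite mul0r.
by rewrite /Rintegral integral0.
Qed.

Lemma nehari_ray V u t : intg mu (fun x => V x * u x ^+ 2) -> ~ D12_zero u -> 0 < t ->
  ray_deriv f u t = t * (dirichlet u + potential V u) ->
  exists w : D12 R N, [/\ nehari f V w, forall x, w x = t * u x &
    energy f V w = (t ^+ 2 / 2 * (dirichlet u + potential V u)
                    - J (fun x => f (t * u x)))%:E].
Proof.
move=> iV u0 t0 E; have [w [wu wG]] := D12_scale t u.
have wE x : w x = t * u x by rewrite wu.
have VE : (fun x => V x * w x ^+ 2) = (fun x => t ^+ 2 * (V x * u x ^+ 2)).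
  by apply/funext => x; rewrite wE; ring.
have iW : intg mu (fun x => V x * w x ^+ 2) by rewrite VE; exact: intgZ.
have pW : potential V w = t ^+ 2 * potential V u by rewrite /potential VE RintZ.
have dW : dirichlet w = t ^+ 2 * dirichlet u.
  rewrite /dirichlet -RintZ; last exact: D12_intg_grad.
  by apply: eq_Rintegral => x _; rewrite wG dotZl dotZr mulrA expr2.
exists w; split => //; last first.
  rewrite energyE// pW dW; congr EFin.
  have -> : J (fun x => f (w x)) = J (fun x => f (t * u x)).
    by apply: eq_Rintegral => x _; rewrite wE.
  by ring.
apply/(nehariE iW); split.
  apply: contra_not u0; apply: filterS => x; rewrite wE => /eqP.
  by rewrite mulf_eq0 gt_eqF//= => /eqP.
rewrite pW dW -mulrDr expr2 -mulrA -E /ray_deriv -RintZ; last first.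
  exact: (intg_f1 N2 hf _ (D12_crit_intg N2 u)).
by apply: eq_Rintegral => x _; rewrite wE mul1r; ring.
Qed.

(** [V] is positive almost everywhere only, so the pointwise nonnegative
    function [|V| u^2] replaces [V u^2]. *)
Lemma potential_gt0 V u : measurable_fun setT V -> intg mu (fun x => V x * u x ^+ 2) ->
  {ae mu, forall x, 0 < V x} -> ~ D12_zero u -> 0 < potential V u.
Proof.
move=> mV iV V0 u0.
have mu_ := measurable_Dfun u.
have mu2 : measurable_fun setT (fun x => u x ^+ 2) by exact: measurable_funX.
have mVu : measurable_fun setT (fun x => `|V x| * u x ^+ 2).
  by apply: measurable_funM => //; exact: measurableT_comp.
have iV' : intg mu (fun x => `|V x| * u x ^+ 2).
  apply: intg_le (integrable_norm iV : intg mu _) => // x.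
  by rewrite /= !normrM normr_id.
have E : potential V u = J (fun x => `|V x| * u x ^+ 2).
  apply: Rint_ae_eq => //; first exact: (intg_measurable iV).
  by apply: filterS V0 => x Vx; rewrite gtr0_norm.
have p0 x : 0 <= `|V x| * u x ^+ 2 by rewrite mulr_ge0// sqr_ge0.
rewrite E lt_neqAle Rint_ge0// andbT eq_sym; apply/eqP => E0; apply: u0.
apply: filterS2 V0 (Rint_eq0 iV' p0 E0) => x Vx /eqP.
by rewrite mulf_eq0 normr_eq0 gt_eqF//= sqrf_eq0 => /eqP.
Qed.

(** A positive potential strictly raises the energy: the ray through a point
    of the Nehari manifold of [V] meets the one of the potential [0] at a
    parameter [t <= 1], and [t = 1] maximises the energy with [V] on the ray. *)
Lemma nehari_tau_below tau V u : (0 < sobolev_const R N)%E ->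
  V \in Lfun mu (N%:R / 2)%:E -> {ae mu, forall x, 0 < V x} ->
  nehari_tau tau f V u -> exists w : D12 R N,
    nehari_tau tau f (fun=> 0) w /\ (energy f (fun=> 0%R) w < energy f V u)%E.
Proof.
move=> S0 hV V0 [nu au].
have iV := potential_intg u hV.
have [u0 uE] := (nehariE iV).1 nu.
have mV : measurable_fun setT V by exact: (set_mem (sub_Lfun_mfun hV)).
have P0 := potential_gt0 mV iV V0 u0.
have D0 := dirichlet_gt0 S0 u0.
have cu := D12_crit_intg N2 u.
have [|t /andP[t0 t1] tE] := @ray_deriv_solve _ _ N2 _ hf u _ 1 cu D0 ltr01.
  by rewrite mul1r uE lerDl ltW.
have [|w [nw wE we]] := nehari_ray (intg_potential0 u) u0 t0.
  by rewrite potential0 addr0.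
exists w; split.
  by split => //; apply: filterS au => x ux; rewrite !wE ux mulrN.
rewrite we (energyE iV) potential0 addr0 lte_fin.
have := ray_energy_max N2 hf cu t0 uE.
have : 0 < t ^+ 2 / 2 * potential V u by rewrite mulr_gt0// divr_gt0// exprn_gt0.
move: (t ^+ 2) (dirichlet u) (potential V u) (J _) (J _) => t2 A P j1 j2.
by clear; lra.
Qed.

Lemma Rint_orth (L : {linear 'rV[R]_N -> 'rV[R]_N}) (h : 'rV[R]_N -> R) :
  orthogonal_map L -> involutive L -> measurable_fun setT h -> (forall x, 0 <= h x) ->
  J (fun x => h (L x)) = J h.
Proof.
move=> oL iL mh h0; congr fine.
rewrite (@ge0_integral_rV_orth _ _ L (EFin \o h))//.
exact/measurable_EFinP.
Qed.

(** The positive parts of [u] and [-u] are exchanged by [tau], hence carry half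
    of every even nonlinear quantity each. *)
Lemma positive_part_half (L : {linear 'rV[R]_N -> 'rV[R]_N}) (u : 'rV[R]_N -> R)
    (G : R -> R) :
  orthogonal_map L -> involutive L -> measurable_fun setT u ->
  {ae mu, forall x, u (L x) = - u x} ->
  continuous G -> (forall s, 0 <= G s) -> (forall s, G (- s) = G s) -> G 0 = 0 ->
  intg mu (fun x => G (u x)) ->
  J (fun x => G (Num.max (u x) 0)) = J (fun x => G (u x)) / 2 /\
  J (fun x => G (Num.max (- u x) 0)) = J (fun x => G (u x)) / 2.
Proof.
move=> oL iL mu_ au cG G0 Ge G00 iG.
have mp : measurable_fun setT (fun x => Num.max (u x) 0) by exact: measurable_maxr.
have mm : measurable_fun setT (fun x => Num.max (- u x) 0).
  by apply: measurable_maxr => //; exact: measurableT_comp.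
have mGp : measurable_fun setT (fun x => G (Num.max (u x) 0)).
  exact: measurable_comp_cont.
have mGm : measurable_fun setT (fun x => G (Num.max (- u x) 0)).
  exact: measurable_comp_cont.
have split_G x : G (Num.max (u x) 0) + G (Num.max (- u x) 0) = G (u x).
  case: (ltgtP (u x) 0) => [ux|ux|->]; last by rewrite oppr0 maxxx G00 addr0.
    rewrite max_l; last by rewrite oppr_ge0 ltW.
    by rewrite G00 add0r Ge.
  rewrite max_r; last by rewrite oppr_le0 ltW.
  by rewrite G00 addr0.
have ip : intg mu (fun x => G (Num.max (u x) 0)).
  by apply: intg_le iG => // x; rewrite ger0_norm// -split_G lerDl.
have im : intg mu (fun x => G (Num.max (- u x) 0)).
  by apply: intg_le iG => // x; rewrite ger0_norm// -split_G lerDr.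
have E1 : J (fun x => G (Num.max (- u x) 0)) = J (fun x => G (Num.max (u x) 0)).
  rewrite -(Rint_orth oL iL mGp)//; apply: Rint_ae_eq => //.
    exact: (measurableT_comp mGp (measurable_linear_rV L)).
  by apply: filterS au => x ->.
have : J (fun x => G (u x)) =
  J (fun x => G (Num.max (u x) 0)) + J (fun x => G (Num.max (- u x) 0)).
  by rewrite -RintD//; apply: eq_Rintegral => x _; rewrite split_G.
by rewrite E1; split; lra.
Qed.

(** The gradients of the positive parts of [u] and [-u] are [a Dgrad u] and
    [- (1 - a) Dgrad u] with [0 <= a <= 1], so one of the two, [w], has at
    most half of the Dirichlet energy of [u], while it has exactly half of the
    nonlinear terms. Its projection [t w] on the Nehari manifold then has at most
    half of the energy of [t u], which is at most that of [u]. *)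
Lemma nehari_half (L : {linear 'rV[R]_N -> 'rV[R]_N}) u : (0 < sobolev_const R N)%E ->
  orthogonal_map L -> involutive L -> nehari_tau L f (fun=> 0) u ->
  exists w : D12 R N, nehari f (fun=> 0) w /\
    (2%:E * energy f (fun=> 0%R) w <= energy f (fun=> 0%R) u)%E.
Proof.
move=> S0 oL iL [nu au].
have [u0 uE] := (nehariE (intg_potential0 u)).1 nu.
rewrite potential0 addr0 in uE.
have cu := D12_crit_intg N2 u.
have mu_ := measurable_Dfun u.
have [um [umu umG]] := D12_scale (- 1) u.
have [wp [wpu wpG]] := D12_pos N2 u.
have [wm [wmu wmG]] := D12_pos N2 um.
have {}wmu : Dfun wm = (fun x => Num.max (- u x) 0).
  by rewrite wmu umu; apply/funext => x; rewrite mulN1r.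
have iu := D12_intg_grad u.
have D2 : dirichlet wp + dirichlet wm <= dirichlet u.
  have ip := D12_intg_grad wp; have im := D12_intg_grad wm.
  rewrite /dirichlet -RintD//; apply: Rint_le => //; first exact: intgD.
  move=> x; rewrite wpG wmG umG umu !dotZl !dotZr [in heaviside (- 1 * _)]mulN1r heavisideN.
  set d := dot _ _.
  have := heaviside_bounds (u x); move: (heaviside _) => a /andP[a0 a1].
  rewrite [leLHS](_ : _ = (a * a + (1 - a) * (1 - a)) * d); last by ring.
  rewrite ler_piMl ?dot_ge0//; nra.
have half_f t : J (fun x => f (t * wp x)) = J (fun x => f (t * u x)) / 2 /\
                J (fun x => f (t * wm x)) = J (fun x => f (t * u x)) / 2.
  rewrite wpu wmu.
  apply: (@positive_part_half L u (fun s => f (t * s))) => //.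
  - move=> s; have C : {for s, continuous (fun s : R => t * s)}.
      exact: (@continuousM _ _ (cst t) id s (@cst_continuous _ _ t s) (@cvg_id _ _)).
    exact: (continuous_comp C (continuous_f hf (x:=_))).
  - by move=> s; exact: (f_ge0 hf _).
  - by move=> s; rewrite mulrN (f_even hf).
  - by rewrite mulr0 (f_0 hf).
  - exact: (intg_f N2 hf (crit_intgZ t cu)).
have half_d : ray_deriv f wp 1 = dirichlet u / 2 /\ ray_deriv f wm 1 = dirichlet u / 2.
  rewrite -uE wpu wmu.
  apply: (@positive_part_half L u (fun s => f1 (1 * s) * s)) => //.
  - move=> s; under [X in continuous_at _ X]funext do rewrite mul1r.
    exact: (@continuousM _ _ f1 id s (continuous_f1 hf (x:=s)) (@cvg_id _ _)).
  - by move=> s; rewrite mul1r; exact: (f1M_ge0 hf _).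
  - by move=> s; rewrite !mul1r (f1M_even hf).
  - by rewrite mulr0.
  - exact: (intg_f1 N2 hf 1 cu).
have [w [Dw fw dw]] : exists w : D12 R N, [/\ dirichlet w <= dirichlet u / 2,
    forall t, J (fun x => f (t * w x)) = J (fun x => f (t * u x)) / 2 &
    ray_deriv f w 1 = dirichlet u / 2].
  have [h|h] := leP (dirichlet wp) (dirichlet u / 2).
    by exists wp; split=> // [t|]; [case: (half_f t)|case: half_d].
  by exists wm; split=> [|t|]; [lra|case: (half_f t)|case: half_d].
have w0 : ~ D12_zero w.
  move=> wz; have := Rint_f_gt0 N2 hf cu u0; have := fw 1.
  have -> : J (fun x => f (1 * w x)) = 0.
    have -> : (0 : R) = J (fun=> 0) by rewrite /Rintegral integral0.
    apply: Rint_ae_eq => //.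
      exact: (intg_measurable (intg_f N2 hf (crit_intgZ 1 (D12_crit_intg N2 w)))).
    by apply: filterS wz => x ->; rewrite mulr0 (f_0 hf).
  have -> : J (fun x => f (1 * u x)) = J (fun x => f (u x)).
    by apply: eq_Rintegral => x _; rewrite mul1r.
  by lra.
have [|t /andP[t0 t1] tE] :=
    @ray_deriv_solve _ _ N2 _ hf w _ 1 (D12_crit_intg N2 w) (dirichlet_gt0 S0 w0) ltr01.
  by rewrite mul1r dw.
have [|z [nz _ ze]] := nehari_ray (intg_potential0 w) w0 t0.
  by rewrite potential0 addr0.
exists z; split => //.
rewrite ze (energyE (intg_potential0 u)) !potential0 !addr0 -EFinM lee_fin fw.
have := ray_energy_max N2 hf cu t0 uE.
have : t ^+ 2 * dirichlet w <= t ^+ 2 * (dirichlet u / 2).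
  by rewrite ler_wpM2l ?sqr_ge0.
move: (t ^+ 2) (dirichlet u) (dirichlet w) (J _) (J _) => t2 A B j1 j2.
by clear; lra.
Qed.

End nehari_levels.

(** * Approximation of the energy by test functions *)

Section test_function_near.
Context {R : realType} {N : nat} (N2 : (2 < N)%N).
Context (f : R -> R) (hf : admissible_nonlinearity N f).
Local Notation r := (@crit_exp R N).
Local Notation mu := (lebesgue_rV R N).
Local Notation J h := (Rintegral mu setT h).
Implicit Types (u w : D12 R N) (V : 'rV[R]_N -> R).

Lemma dot_weighted_triangle (x y : 'rV[R]_N) (eta : R) : 0 < eta ->
  dot (x + y) (x + y) <= (1 + eta^-1) * dot x x + (1 + eta) * dot y y.
Proof.
move=> e0; have := dot_ge0 (eta^-1 *: x - y).
rewrite !dotDl !dotDr !dotNl !dotNr !dotZl !dotZr (dotC y x).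
set a := dot x x; set b := dot x y; set c := dot y y => h.
have : 0 <= eta * (eta^-1 * (eta^-1 * a) - eta^-1 * b + (- (eta^-1 * b) - - c)).
  by rewrite mulr_ge0// ltW.
have -> : eta * (eta^-1 * (eta^-1 * a) - eta^-1 * b + (- (eta^-1 * b) - - c)) =
  eta^-1 * a - 2 * b + eta * c by field; exact: lt0r_neq0.
by lra.
Qed.

(** Compare [|a - b|] with [th (|b| + |a - b|)] in the mean value inequality for
    [f]. *)
Lemma f_diff_bound : exists2 c, 0 < c & forall a b th : R, 0 < th <= 1 ->
  `|f a - f b| <= c * (th * 2 `^ r * `|b| `^ r +
                       (2 `^ r + th^-1 `^ r) * `|a - b| `^ r).
Proof.
have r2 : 2 < r := @crit_exp_gt2 R N N2.
have [c c0 H] := f_growth N2 hf; exists c => // a b th /andP[th0 th1].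
pose M := `|b| + `|a - b|.
have M0 : 0 <= M by rewrite addr_ge0.
have aM : `|a| <= M.
  by rewrite -{1}(subrK b a) (le_trans (ler_normD _ _))// addrC.
have bM : `|b| <= M by rewrite lerDl.
have [_ h] := H _ _ _ aM bM; apply: (le_trans h).
rewrite -mulrA ler_pM2l//.
have P2 : 0 <= 2 `^ r :> R by exact: powR_ge0.
have Pa : 0 <= `|a - b| `^ r by exact: powR_ge0.
have Pb : 0 <= `|b| `^ r by exact: powR_ge0.
have Pt : 0 <= th^-1 `^ r by exact: powR_ge0.
have Mr : M `^ r <= 2 `^ r * (`|b| `^ r + `|a - b| `^ r).
  have := @powR_triangle R (`|b|) (`|a - b|) r (crit_exp_gt0 N2).
  by rewrite !normr_id ger0_norm.
have rM : M `^ (r - 1) * M = M `^ r by rewrite -powRS ?subrK//; lra.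
have Q0 : 0 <= M `^ (r - 1) by exact: powR_ge0.
have [abM|abM] := leP `|a - b| (th * M).
  apply: (@le_trans _ _ (th * M `^ r)).
    by rewrite -rM mulrCA ler_wpM2l.
  apply: (@le_trans _ _ (th * (2 `^ r * (`|b| `^ r + `|a - b| `^ r)))).
    by rewrite ler_pM2l.
  have : th * (2 `^ r * `|a - b| `^ r) <= 2 `^ r * `|a - b| `^ r.
    by rewrite ler_piMl// mulr_ge0.
  have : 0 <= th^-1 `^ r * `|a - b| `^ r by rewrite mulr_ge0.
  by lra.
apply: (@le_trans _ _ (th^-1 `^ r * `|a - b| `^ r)).
  rewrite -powRM ?invr_ge0 ?(ltW th0)//.
  set y := th^-1 * `|a - b|.
  have My : M <= y by rewrite /y ler_pdivlMl// ltW.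
  have y0 : 0 <= y by exact: le_trans My.
  have aby : `|a - b| <= y by rewrite /y ler_peMl// invf_ge1.
  have -> : y `^ r = y `^ (r - 1) * y by rewrite -powRS ?subrK//; lra.
  apply: ler_pM => //.
  by rewrite ge0_ler_powR ?nnegrE//; lra.
have : 0 <= th * 2 `^ r * `|b| `^ r by rewrite !mulr_ge0// ltW.
have : 0 <= 2 `^ r * `|a - b| `^ r by rewrite mulr_ge0.
by lra.
Qed.

(** The nonlinear integrals are close uniformly on segments of rays, as the
    parameter of the projection on the Nehari manifold is known only after
    [phi] has been chosen. *)
Lemma test_near u (T del : R) : 0 < T -> 0 < del -> exists phi,
  [/\ test_function phi,
      J (fun x => dot (gradient phi x) (gradient phi x)) <= dirichlet u + del &
      forall t, 0 <= t <= T ->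
        `|J (fun x => f (t * phi x)) - J (fun x => f (t * u x))| <= del].
Proof.
move=> T0 del0.
have r2 : 2 < r := @crit_exp_gt2 R N N2.
have [c c0 Hc] := f_diff_bound.
have iu := D12_intg_powR N2 u; have iG := D12_intg_grad u.
set B := J (fun x => `|u x| `^ r).
have B0 : 0 <= B by apply: Rint_ge0 => x; exact: powR_ge0.
have A0 : 0 <= dirichlet u by apply: Rint_ge0 => x; exact: dot_ge0.
(* [eta] and [e] control the Dirichlet energy, [th] and [e] the other term;
   each of the four errors gets the share [del / 2] *)
pose eta := del / 2 / (1 + dirichlet u).
have eta0 : 0 < eta by rewrite !divr_gt0// ltr_pwDl.
have etaA : eta * dirichlet u <= del / 2.
  by rewrite /eta mulrAC ler_pdivrMr ?ltr_pwDl// ler_pM2l; lra.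
pose C1 := c * T `^ r * 2 `^ r.
have C10 : 0 < C1 by rewrite !mulr_gt0// powR_gt0.
pose th := Num.min 1 (del / 2 / (1 + C1 * B)).
have CB : 0 < 1 + C1 * B by rewrite ltr_pwDl// mulr_ge0// ltW.
have th0 : 0 < th by rewrite lt_min ltr01 !divr_gt0.
have th1 : th <= 1 by rewrite ge_min lexx.
have thB : C1 * th * B <= del / 2.
  have : th * (1 + C1 * B) <= del / 2 by rewrite -ler_pdivlMr// ge_min lexx orbT.
  by nra.
pose C2 := c * T `^ r * (2 `^ r + th^-1 `^ r).
have C20 : 0 < C2 by rewrite !mulr_gt0 ?powR_gt0// ltr_pwDl ?powR_ge0 ?powR_gt0.
pose e := Num.min (del / 2 / (1 + eta^-1)) (del / 2 / C2).
have ie0 : 0 < 1 + eta^-1 by rewrite ltr_pwDl// invr_ge0 ltW.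
have e0 : 0 < e by rewrite lt_min !divr_gt0.
have eA : (1 + eta^-1) * e <= del / 2.
  by rewrite mulrC -ler_pdivlMr// ge_min lexx.
have eC : C2 * e <= del / 2.
  by rewrite mulrC -ler_pdivlMr// ge_min lexx orbT.
have [phi [tphi i1 j1 i2 j2]] := D12_in_closure u e0.
exists phi; split => //.
  have ib := intgD (intgZ (1 + eta^-1) i1) (intgZ (1 + eta) iG).
  apply: (@le_trans _ _ ((1 + eta^-1) *
      J (fun x => dot (gradient phi x - Dgrad u x) (gradient phi x - Dgrad u x)) +
      (1 + eta) * dirichlet u)).
    rewrite /dirichlet -!RintZ// -RintD; [|exact: intgZ|exact: intgZ].
    apply: Rint_le => //; first exact: test_intg_grad.
    move=> x; rewrite -{1 2}(subrK (Dgrad u x) (gradient phi x)).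
    exact: dot_weighted_triangle.
  have : (1 + eta^-1) * J (fun x => dot (gradient phi x - Dgrad u x)
      (gradient phi x - Dgrad u x)) <= (1 + eta^-1) * e.
    by rewrite ler_pM2l// ltW.
  by lra.
move=> t /andP[t0 tT].
have cphi : crit_intg phi.
  split; first exact: measurable_test.
  exact: (test_intg_powR (crit_exp_gt0 N2) tphi).
have k1 := intg_f N2 hf (crit_intgZ t cphi).
have k2 := intg_f N2 hf (crit_intgZ t (D12_crit_intg N2 u)).
rewrite -RintB//.
apply: le_trans (le_normr_Rintegral measurableT (intgB k1 k2)) _.
have k3 := intgD (intgZ (C1 * th) iu) (intgZ C2 i2).
apply: (@le_trans _ _ (C1 * th * B + C2 * J (fun x => `|phi x - u x| `^ r))); last first.
  have : C2 * J (fun x => `|phi x - u x| `^ r) <= C2 * e by rewrite ler_pM2l// ltW.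
  by lra.
rewrite /B -!RintZ// -RintD; [|exact: intgZ|exact: intgZ].
apply: Rint_le => //; first exact: (integrable_norm (intgB k1 k2)).
move=> x; have thb : 0 < th <= 1 by rewrite th0.
apply: le_trans (Hc _ _ _ thb) _.
have tr : t `^ r <= T `^ r by rewrite ge0_ler_powR ?nnegrE// ?ltW//; lra.
rewrite -mulrBr !normrM (ger0_norm t0) !powRM//.
have Pa : 0 <= `|phi x - u x| `^ r by exact: powR_ge0.
have Pb : 0 <= `|u x| `^ r by exact: powR_ge0.
have P2 : 0 < 2 `^ r :> R by rewrite powR_gt0.
have Pt : 0 <= th^-1 `^ r by exact: powR_ge0.
rewrite [leRHS](_ : _ = c * (th * 2 `^ r * (T `^ r * `|u x| `^ r) +
   (2 `^ r + th^-1 `^ r) * (T `^ r * `|phi x - u x| `^ r))); last first.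
  by rewrite /C1 /C2; ring.
rewrite ler_pM2l// lerD//; apply: ler_wpM2l.
- by rewrite mulr_ge0 ?ltW.
- exact: ler_wpM2r.
- by rewrite addr_ge0// ltW.
- exact: ler_wpM2r.
Qed.

End test_function_near.

(** * Bumps that escape to infinity *)

Section two_bumps.
Context {R : realType} {N : nat} (N2 : (2 < N)%N).
Context (f : R -> R) (hf : admissible_nonlinearity N f).
Context (tau : {linear 'rV[R]_N -> 'rV[R]_N}) (otau : orthogonal_map tau)
  (itau : involutive tau).
Local Notation r := (@crit_exp R N).
Local Notation mu := (lebesgue_rV R N).
Local Notation J h := (Rintegral mu setT h).
Implicit Types (V phi : 'rV[R]_N -> R).

Lemma Rint_shift (h : 'rV[R]_N -> R) b : measurable_fun setT h -> (forall x, 0 <= h x) ->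
  J (fun x => h (x + b)) = J h.
Proof.
move=> mh h0; congr fine.
rewrite (@ge0_integral_rV_shift _ _ b (EFin \o h))//.
exact/measurable_EFinP.
Qed.

Lemma measurable_affine (L : {linear 'rV[R]_N -> 'rV[R]_N}) b :
  measurable_fun setT (fun x => L x + b).
Proof. by apply: measurable_rV_add => //; exact: measurable_linear_rV. Qed.

Lemma Rint_affine (L : {linear 'rV[R]_N -> 'rV[R]_N}) (h : 'rV[R]_N -> R) b :
  orthogonal_map L -> involutive L -> measurable_fun setT h -> (forall x, 0 <= h x) ->
  J (fun x => h (L x + b)) = J h.
Proof.
move=> oL iL mh h0; rewrite -(Rint_shift b mh h0).
apply: (Rint_orth (h := fun x => h (x + b))) => //.
exact: (measurableT_comp mh (measurable_affine idfun b)).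
Qed.

Lemma intg_affine (L : {linear 'rV[R]_N -> 'rV[R]_N}) (h : 'rV[R]_N -> R) b :
  orthogonal_map L -> involutive L -> (forall x, 0 <= h x) -> intg mu h ->
  intg mu (fun x => h (L x + b)).
Proof.
move=> oL iL h0 ih; have mh := intg_measurable ih.
have mhb : measurable_fun setT (fun x : 'rV[R]_N => h (x + b)).
  exact: (measurableT_comp mh (measurable_affine idfun b)).
apply: intg_ge0 => //.
  exact: (measurableT_comp mh (measurable_affine L b)).
have mE : measurable_fun setT (fun x : 'rV[R]_N => (h (x + b))%:E).
  exact/measurable_EFinP.
have E0 (x : 'rV[R]_N) : (0 <= (h (x + b))%:E)%E by rewrite lee_fin.
rewrite (ge0_integral_rV_orth oL iL mE E0).
have mE' : measurable_fun setT (EFin \o h) by exact/measurable_EFinP.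
have E0' (x : 'rV[R]_N) : (0 <= (EFin \o h) x)%E by rewrite lee_fin.
rewrite (ge0_integral_rV_shift b mE' E0').
by rewrite (integral_intg ih) ltry.
Qed.

Lemma dot_dball_lower (e z : 'rV[R]_N) M : dball M z -> - (M + dot e e) <= 2 * dot z e.
Proof.
rewrite /dball /= => zM.
have := dot_ge0 (z + e); rewrite !dotDl !dotDr (dotC e z); lra.
Qed.

(** Pairing with [e]: the first ball lies in a half-space [dot x e > 0] and, as
    [tau e = - e], the second one in the opposite half-space. *)
Lemma far_apart (e : 'rV[R]_N) (M : R) (n : nat) x : tau e = - e ->
  M + dot e e < n%:R * dot e e ->
  ~ dball M (x + - (n%:R *: e)) \/ ~ dball M (tau x + - (n%:R *: e)).
Proof.
move=> te H; have [h1|h1] := pselect (dball M (x + - (n%:R *: e))); last by left.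
right=> h2; move: h1 h2; rewrite /dball /= => h1 h2.
have P y : dot (y + - (n%:R *: e)) (y + - (n%:R *: e)) <= M ->
    2 * n%:R * dot e e - (M + dot e e) <= 2 * dot y e.
  by move=> /(dot_dball_lower e); rewrite dotDl dotNl dotZl; lra.
have := P _ h1; have := P _ h2.
have -> : dot (tau x) e = - dot x e.
  by rewrite -otau itau te dotNr.
by have := mulr_ge0 (ler0n R n) (dot_ge0 e); lra.
Qed.

(** With [m = N/2], [|V| <= eta + eta^(1-m) |V|^m]. The first term contributes
    [eta] times the square of the norm of [phi] in [L^2], for every [n]. The
    second one is integrable, and the translates of the support of [phi] lie in
    half-spaces [rho n <= dot x e] with [rho n] tending to infinity. *)
Lemma potential_far V phi (e : 'rV[R]_N) (del : R) : V \in Lfun mu (N%:R / 2)%:E ->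
  test_function phi -> 0 < dot e e -> 0 < del ->
  \forall n \near \oo,
    J (fun x => `|V x| * phi (x + - (n%:R *: e)) ^+ 2) <= del.
Proof.
move=> hV tphi e0 del0.
have N2' : (2 : R) < N%:R by rewrite ltr_nat.
set m : R := N%:R / 2.
have m1 : 1 <= m by rewrite /m; lra.
have m0 : 0 < m by lra.
have iV : intg mu (fun x => `|V x| `^ m) := Lfun_integrable m1 hV.
have mV : measurable_fun setT V by exact: (set_mem (sub_Lfun_mfun hV)).
have [K HK] := test_bounded tphi.
have [_ [M HM]] := (test_functionP _).1 tphi.
have iphi : intg mu (fun x => phi x ^+ 2).
  apply: (@bounded_support_integrable _ _ _ (K ^+ 2) M).
  - by apply: measurable_funX; exact: measurable_test.
  - by move=> x; rewrite normrX lerXn2r ?nnegrE// (le_trans _ (HK x)).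
  - by move=> x; rewrite sqrf_eq0; exact: HM.
have mphi2 := intg_measurable iphi.
have B0 : 0 <= J (fun x => phi x ^+ 2) by apply: Rint_ge0 => x; exact: sqr_ge0.
pose eta := del / 2 / (1 + J (fun x => phi x ^+ 2)).
have eta0 : 0 < eta by rewrite !divr_gt0// ltr_pwDl.
have etaB : eta * J (fun x => phi x ^+ 2) <= del / 2.
  by rewrite /eta mulrAC ler_pdivrMr ?ltr_pwDl// ler_pM2l; lra.
pose C := eta * eta^-1 `^ m * K ^+ 2.
have q0 : 0 <= eta * eta^-1 `^ m by apply: mulr_ge0; [exact: ltW|exact: powR_ge0].
have C0 : 0 <= C by apply: mulr_ge0 => //; exact: sqr_ge0.
pose rho (n : nat) := n%:R * dot e e - (M + dot e e) / 2.
pose g (n : nat) x := if rho n <= dot x e then `|V x| `^ m else 0.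
have mg n : measurable_fun setT (g n).
  apply: measurable_fun_ifT => //; last exact: intg_measurable iV.
  by apply: measurable_fun_ler => //; apply: measurable_dot.
have gV n x : 0 <= g n x <= `|V x| `^ m.
  by rewrite /g; case: ifP; rewrite ?lexx powR_ge0.
have g0 x : g n x @[n --> \oo] --> 0.
  apply: cvg_near_cst.
  have : \forall n \near \oo, (dot x e + (M + dot e e) / 2) / dot e e < n%:R.
    exact: nbhs_infty_gtr.
  apply: filterS => n; rewrite ltr_pdivrMr// => H.
  by rewrite /g ifF//; apply/negbTE; rewrite -ltNge /rho; lra.
have ed : 0 < del / 2 / (1 + C) by rewrite !divr_gt0// ltr_pwDl.
apply: filterS (dominated_cvg0 mg iV gV g0 ed) => n Jn.
have ig : intg mu (g n).
  by apply: intg_le iV => // x; have /andP[? ?] := gV n x; rewrite ger0_norm.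
pose ph x := phi (x + - (n%:R *: e)) ^+ 2.
have ip : intg mu ph.
  by apply: (@intg_affine idfun (fun x => phi x ^+ 2)) => // x; exact: sqr_ge0.
have Jp : J ph = J (fun x => phi x ^+ 2).
  by apply: (@Rint_shift (fun x => phi x ^+ 2)) => // x; exact: sqr_ge0.
have P x : `|V x| * ph x <= eta * ph x + C * g n x.
  have ph0 : 0 <= ph x by exact: sqr_ge0.
  have [p0|p0] := eqVneq (phi (x + - (n%:R *: e))) 0.
    rewrite /ph p0 expr0n /= !mulr0 add0r mulr_ge0//.
    by have /andP[] := gV n x.
  have phK : ph x <= K ^+ 2.
    rewrite /ph -real_normK ?num_real// lerXn2r ?nnegrE//.
    exact: le_trans (HK 0).
  have -> : g n x = `|V x| `^ m.
    rewrite /g ifT// /rho.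
    have := dot_dball_lower e (HM _ p0); rewrite dotDl dotNl dotZl; lra.
  have VB : `|V x| <= eta + eta * eta^-1 `^ m * `|V x| `^ m.
    have qV0 : 0 <= eta * eta^-1 `^ m * `|V x| `^ m by rewrite mulr_ge0// powR_ge0.
    have [h|h] := leP `|V x| eta; first by lra.
    apply: (@le_trans _ _ (eta * eta^-1 `^ m * `|V x| `^ m)); last by lra.
    rewrite -mulrA -powRM// ?invr_ge0 ?(ltW eta0)//.
    have h1 : 1 <= eta^-1 * `|V x| by rewrite ler_pdivlMl// mulr1 ltW.
    have := le1r_powR h1 m1; rewrite ler_pdivrMl//.
  apply: le_trans (ler_wpM2r ph0 VB) _.
  rewrite mulrDl lerD2l /C.
  rewrite [leRHS](_ : _ = eta * eta^-1 `^ m * `|V x| `^ m * K ^+ 2); last by ring.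
  by rewrite ler_wpM2l// mulr_ge0// powR_ge0.
have iB := intgD (intgZ eta ip) (intgZ C ig).
have iL : intg mu (fun x => `|V x| * ph x).
  apply: intg_le iB => [|x].
    apply: measurable_funM; [exact: measurableT_comp|exact: intg_measurable ip].
  by rewrite ger0_norm// mulr_ge0// sqr_ge0.
apply: le_trans (Rint_le iL iB P) _.
rewrite RintD ?RintZ// ?Jp; [|exact: intgZ|exact: intgZ].
have : C * J (g n) <= del / 2.
  have : J (g n) * (1 + C) <= del / 2 by rewrite -ler_pdivlMr ?ltr_pwDl// ltW.
  have : 0 <= J (g n) by apply: Rint_ge0 => x; have /andP[] := gV n x.
  by nra.
by lra.
Qed.

End two_bumps.

(** * The upper bound *)

Section nehari_above.
Context {R : realType} {N : nat} (N2 : (2 < N)%N).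
Context (f : R -> R) (hf : admissible_nonlinearity N f).
Context (tau : {linear 'rV[R]_N -> 'rV[R]_N}) (otau : orthogonal_map tau)
  (itau : involutive tau).
Local Notation r := (@crit_exp R N).
Local Notation mu := (lebesgue_rV R N).
Local Notation J h := (Rintegral mu setT h).
Implicit Types (V phi : 'rV[R]_N -> R) (u : D12 R N).

(** [z] is the difference of two copies of [phi], pushed apart in opposite
    directions along a vector [e] with [tau e = - e]. At every point one of them
    vanishes together with its gradient, so every term of the energy splits, and
    the potential is small far away. *)
Lemma two_bumps V phi (del : R) : (exists x, tau x <> x) ->
  V \in Lfun mu (N%:R / 2)%:E -> {ae mu, forall x, V (tau x) = V x} ->
  {ae mu, forall x, 0 < V x} -> test_function phi -> 0 < del ->
  exists z : D12 R N, [/\ tau_antisymmetric tau z,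
    dirichlet z = 2 * J (fun x => dot (gradient phi x) (gradient phi x)),
    potential V z <= 2 * del &
    forall t, J (fun x => f (t * z x)) = 2 * J (fun x => f (t * phi x))].
Proof.
move=> [x0 tx0] hV Vtau V0 tphi del0.
pose e := x0 - tau x0.
have te : tau e = - e by rewrite /e linearB itau opprB.
have e0 : 0 < dot e e.
  rewrite lt_neqAle dot_ge0 andbT eq_sym; apply/eqP => /dot_eq0/eqP.
  by rewrite subr_eq0 => /eqP h; apply: tx0.
have [sphi [M HM]] := (test_functionP _).1 tphi.
have [n [nM nW]] : exists n : nat, M + dot e e < n%:R * dot e e /\
    J (fun x => `|V x| * phi (x + - (n%:R *: e)) ^+ 2) <= del.
  have [K1 _ h1] := potential_far N2 hV tphi e0 del0.
  have [K2 _ h2] : \forall n \near \oo, (M + dot e e) / dot e e < n%:R.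
    exact: nbhs_infty_gtr.
  exists (maxn K1 K2); split; last exact: (h1 _ (leq_maxl _ _)).
  by rewrite -ltr_pdivrMr//; exact: (h2 _ (leq_maxr _ _)).
set b := - (n%:R *: e) in nW.
pose p1 x := phi (x + b); pose p2 x := phi (tau x + b).
have oid : orthogonal_map (idfun : 'rV[R]_N -> 'rV[R]_N) by [].
have iid : involutive (idfun : 'rV[R]_N -> 'rV[R]_N) by [].
have t1 : test_function p1 by exact: (test_affine (L := idfun) b oid tphi).
have t2 : test_function p2 by exact: (test_affine b otau tphi).
have [z [zE zG]] := D12_test N2 (testB t1 t2).
have g1 x : gradient p1 x = gradient phi (x + b).
  exact: (gradient_affine (L := idfun) b x oid _ sphi).
have g2 x : gradient p2 x = tau (gradient phi (tau x + b)).
  exact: gradient_affine.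
have out y : ~ dball M y -> phi y = 0 /\ gradient phi y = 0.
  move=> My; split; last exact: gradient_out HM My.
  by apply/eqP; apply: contra_notT My; exact: HM.
have sep x : (p1 x = 0 /\ gradient p1 x = 0) \/ (p2 x = 0 /\ gradient p2 x = 0).
  have [/out[h1 h2]|/out[h1 h2]] := far_apart otau itau x te nM.
    by left; rewrite g1.
  by right; rewrite g2 h2 linear0.
have zx x : z x = p1 x - p2 x by rewrite zE.
have mphi := measurable_test tphi.
have mV : measurable_fun setT V by exact: (set_mem (sub_Lfun_mfun hV)).
exists z; split.
- apply: aeW => x; rewrite !zx /p1 /p2 itau opprB //.
- pose h y := dot (gradient phi y) (gradient phi y).
  have h0 y : 0 <= h y by exact: dot_ge0.
  have ih : intg mu h by exact: test_intg_grad.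
  have -> : dirichlet z = J (fun x => h (x + b) + h (tau x + b)).
    apply: eq_Rintegral => x _; rewrite zG gradientB; try exact: test_smooth.
    rewrite /h -(otau (gradient phi (tau x + b))) -g1 -g2.
    by case: (sep x) => -[_ ->]; rewrite ?sub0r ?subr0 ?dotNl ?dotNr ?opprK dot0l ?add0r ?addr0.
  rewrite (RintD (intg_affine (L := idfun) b oid iid h0 ih) (intg_affine b otau itau h0 ih)).
  have mh := intg_measurable ih.
  by rewrite (Rint_shift b mh h0) (Rint_affine b otau itau mh h0) mulr_natl mulr2n.
- have ip1 : intg mu (fun x => `|V x| * p1 x ^+ 2).
    have [w [wE _]] := D12_test N2 t1.
    have := potential_intg N2 w hV; rewrite wE => i.
    apply: intg_le (integrable_norm i : intg mu _) => [|x].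
      apply: measurable_funM; first exact: measurableT_comp.
      by apply: measurable_funX; exact: measurable_test.
    by rewrite /= !normrM normr_id.
  have q0 x : 0 <= `|V x| * p1 x ^+ 2 by rewrite mulr_ge0 ?sqr_ge0.
  have mq := intg_measurable ip1.
  have E2 : {ae mu, forall x, `|V x| * p2 x ^+ 2 = `|V (tau x)| * p1 (tau x) ^+ 2}.
    by apply: filterS Vtau => x ->.
  have ip2 : intg mu (fun x => `|V (tau x)| * p1 (tau x) ^+ 2).
    have := intg_affine 0 otau itau q0 ip1.
    by under [X in intg _ X -> _]funext do rewrite addr0.
  have -> : potential V z = J (fun x => `|V x| * p1 x ^+ 2 + `|V (tau x)| * p1 (tau x) ^+ 2).
    apply: Rint_ae_eq.
    - exact: (intg_measurable (potential_intg N2 z hV)).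
    - exact: (intg_measurable (intgD ip1 ip2)).
    apply: filterS2 V0 E2 => x Vx <-; rewrite gtr0_norm// zx.
    by case: (sep x) => -[-> _]; ring.
  rewrite RintD// (Rint_orth (h := fun x => `|V x| * p1 x ^+ 2) otau itau mq q0).
  have : J (fun x => `|V x| * p1 x ^+ 2) <= del := nW.
  by lra.
- move=> t; pose h y := f (t * phi y).
  have h0 y : 0 <= h y by exact: (f_ge0 hf).
  have cphi : crit_intg phi.
    by split => //; exact: (test_intg_powR (crit_exp_gt0 N2) tphi).
  have ih : intg mu h by exact: (intg_f N2 hf (crit_intgZ t cphi)).
  have -> : J (fun x => f (t * z x)) = J (fun x => h (x + b) + h (tau x + b)).
    apply: eq_Rintegral => x _; rewrite zx /h -/(p1 x) -/(p2 x).
    case: (sep x) => -[-> _]; rewrite ?sub0r ?subr0 ?mulrN ?(f_even hf) mulr0 (f_0 hf).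
      by rewrite add0r.
    by rewrite addr0.
  rewrite (RintD (intg_affine (L := idfun) b oid iid h0 ih) (intg_affine b otau itau h0 ih)).
  have mh := intg_measurable ih.
  by rewrite (Rint_shift b mh h0) (Rint_affine b otau itau mh h0) mulr_natl mulr2n.
Qed.

(** The antisymmetric pair of bumps made from a test function near [u] has
    almost twice the energy of [u] along its ray, uniformly on the bounded
    interval of parameters that contains its projection. The maximality of [u]
    on its own ray concludes. *)
Lemma nehari_above V u (eps : R) : (exists x, tau x <> x) ->
  V \in Lfun mu (N%:R / 2)%:E -> {ae mu, forall x, V (tau x) = V x} ->
  {ae mu, forall x, 0 < V x} -> (0 < sobolev_const R N)%E ->
  nehari f (fun=> 0) u -> 0 < eps -> exists w : D12 R N,
    nehari_tau tau f V w /\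
    (energy f V w <= 2%:E * energy f (fun=> 0%R) u + eps%:E)%E.
Proof.
move=> tx hV Vtau V0 S0 nu eps0.
have [u0 uE] := (nehariE N2 hf (intg_potential0 u)).1 nu.
rewrite potential0 addr0 in uE.
have cu := D12_crit_intg N2 u.
have F0 := Rint_f_gt0 N2 hf cu u0.
set F := J (fun x => f (u x)) in F0.
have A0 := dirichlet_gt0 S0 u0.
have [m m2 G] := ray_deriv_growth N2 hf.
have m0 : 0 < m by lra.
have mF : 0 < m * F * (m - 2) by rewrite !mulr_gt0// subr_gt0.
(* [expR X] bounds the parameters of the projections on the Nehari manifold *)
pose X := (2 * dirichlet u + 4) / (m * F * (m - 2)).
have X0 : 0 <= X by rewrite divr_ge0 ?(ltW mF)//; lra.
pose T := expR X.
have T1 : 1 <= T by rewrite /T -expR0 ler_expR.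
have T0 : 0 < T by lra.
have XF : 2 * dirichlet u + 4 <= m * expR ((m - 2) * X) * F.
  have : (m - 2) * X <= expR ((m - 2) * X).
    by have := expR_ge1Dx ((m - 2) * X); lra.
  move=> h; apply: (@le_trans _ _ (m * F * ((m - 2) * X))).
    have -> : m * F * ((m - 2) * X) = X * (m * F * (m - 2)) by ring.
    by rewrite /X divfK// lt0r_neq0.
  by rewrite [leRHS]mulrAC ler_pM2l// mulr_gt0.
have T2 : 0 < 2 * T ^+ 2 + 2 by rewrite ltr_wpDl// mulr_ge0// sqr_ge0.
pose del := Num.min (Num.min 1 (F / 2)) (eps / (2 * T ^+ 2 + 2)).
have del0 : 0 < del by rewrite !lt_min ltr01 !divr_gt0.
have del1 : del <= 1 by rewrite !ge_min lexx.
have delF : del <= F / 2 by rewrite !ge_min lexx orbT.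
have deleps : del * (2 * T ^+ 2 + 2) <= eps.
  by rewrite -ler_pdivlMr// !ge_min lexx orbT.
have [phi [tphi phiA phif]] := test_near N2 hf u T0 del0.
have [z [az zA zV zf]] := two_bumps tx hV Vtau V0 tphi del0.
have cz := D12_crit_intg N2 z.
have Fz : F <= J (fun x => f (z x)).
  have := phif 1; rewrite ler01 T1 => /(_ isT).
  have -> : J (fun x => f (z x)) = J (fun x => f (1 * z x)).
    by apply: eq_Rintegral => x _; rewrite mul1r.
  have -> : J (fun x => f (1 * u x)) = F.
    by apply: eq_Rintegral => x _; rewrite mul1r.
  by rewrite zf ler_norml => /andP[? ?]; lra.
have z0 : ~ D12_zero z.
  move=> zz; suff : J (fun x => f (z x)) = 0 by lra.
  have -> : (0 : R) = J (fun=> 0) by rewrite /Rintegral integral0.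
  apply: Rint_ae_eq => //; first exact: (intg_measurable (intg_f N2 hf cz)).
  by apply: filterS zz => x ->; rewrite (f_0 hf).
have iV := potential_intg N2 z hV.
have mV : measurable_fun setT V by exact: (set_mem (sub_Lfun_mfun hV)).
have P0 := potential_gt0 mV iV V0 z0.
have D0 := dirichlet_gt0 S0 z0.
set Q := dirichlet z + potential V z.
have Q0 : 0 < Q by rewrite addr_gt0.
have QT : T * Q <= ray_deriv f z T.
  apply: le_trans (G z X cz X0); rewrite ler_pM2l//.
  apply: (@le_trans _ _ (m * expR ((m - 2) * X) * F)); first by rewrite /Q; lra.
  by rewrite ler_pM2l// mulr_gt0// expR_gt0.
have [t /andP[t0 tT] tE] := ray_deriv_solve N2 hf cz Q0 T0 QT.
have [w [nw wE we]] := nehari_ray N2 hf iV z0 t0 tE.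
exists w; split.
  by split => //; apply: filterS az => x zx; rewrite !wE zx mulrN.
rewrite we (energyE N2 hf (intg_potential0 u)) potential0 mul0r addr0.
rewrite -EFinM -EFinD lee_fin -/Q zf -/F.
have tT' : 0 <= t <= T by rewrite (ltW t0).
have := phif t tT'; rewrite ler_norml => /andP[h1 h2].
have h3 := ray_energy_max N2 hf cu t0 uE; rewrite -/F in h3.
have QA : Q <= 2 * dirichlet u + 4 * del.
  rewrite /Q zA; apply: (@le_trans _ _ (2 * (dirichlet u + del) + 2 * del)).
    by apply: lerD => //; rewrite ler_pM2l.
  by rewrite mulrDr -addrA -mulrDl -natrD.
have t2 : 0 <= t ^+ 2 by exact: sqr_ge0.
have tT2 : t ^+ 2 <= T ^+ 2 by rewrite ler_pXn2r ?nnegrE //; exact: ltW.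
have p1 : t ^+ 2 / 2 * Q <= t ^+ 2 / 2 * (2 * dirichlet u + 4 * del).
  by apply: ler_wpM2l => //; rewrite divr_ge0.
have p2 : t ^+ 2 * del <= T ^+ 2 * del by apply: ler_wpM2r => //; exact: ltW.
move: p1 p2 h1 h3 deleps.
move: (t ^+ 2) (T ^+ 2) (Q) (del) (dirichlet u) (F) (J _) (J _) => t2' T2' Q' d A F' j1 j2.
by clear; lra.
Qed.

End nehari_above.

Theorem theorem1 (R : realType) (N : nat) (hN : (3 <= N)%N)
    (f : R -> R) (hf : admissible_nonlinearity N f)
    (tau : {linear 'rV[R]_N -> 'rV[R]_N})
    (tau_orth : orthogonal_map tau)
    (tau_nontrivial : exists x, tau x <> x)
    (tau_inv : forall x, tau (tau x) = x)
    (V : 'rV[R]_N -> R)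
    (hV : V \in Lfun (lebesgue_rV R N) (N%:R / 2)%:E)
    (hV_norm : ('N[lebesgue_rV R N]_((N%:R / 2)%:E) [EFin \o V]
                < sobolev_const R N)%E)
    (hV_tau : {ae lebesgue_rV R N, forall x, V (tau x) = V x})
    (hV_pos : {ae lebesgue_rV R N, forall x, 0 < V x}) :
  [/\ nehari_level_tau tau f V = nehari_level_tau tau f (fun=> 0),
      nehari_level_tau tau f (fun=> 0)
        = (2%:E * nehari_level (N := N) f (fun=> 0%R))%E,
      ~ (exists u : D12 R N,
           nehari_tau tau f V u /\ energy f V u = nehari_level_tau tau f V)
    & ~ (exists u : D12 R N,
           [/\ ~ D12_zero u, weak_solution f V u, (energy f V u < +oo)%E,
               tau_antisymmetric tau u
             & energy f V u = nehari_level_tau tau f V])].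
Proof.
have S0 : (0 < sobolev_const R N)%E by apply: le_lt_trans hV_norm; exact: Lnorm_ge0.
have below u : nehari_tau tau f V u -> exists w : D12 R N,
    nehari_tau tau f (fun=> 0) w /\ (energy f (fun=> 0%R) w < energy f V u)%E.
  exact: nehari_tau_below.
have le1 : (nehari_level_tau tau f (fun=> 0%R) <= nehari_level_tau tau f V)%E.
  apply: le_ereal_inf_tmp => _ [u nu <-]; have [w [nw wu]] := below u nu.
  by apply: le_trans (ltW wu); apply: ereal_inf_lbound; exists w.
have le2 : (2%:E * nehari_level (N := N) f (fun=> 0%R) <=
    nehari_level_tau tau f (fun=> 0%R))%E.
  apply: le_ereal_inf_tmp => _ [u nu <-].
  have [w [nw wu]] := nehari_half hN hf S0 tau_orth tau_inv nu.
  apply: le_trans wu; rewrite lee_pmul2l//.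
  by apply: ereal_inf_lbound; exists w.
have le3 : (nehari_level_tau tau f V <= 2%:E * nehari_level (N := N) f (fun=> 0%R))%E.
  rewrite muleC -lee_pdivrMr//; apply: le_ereal_inf_tmp => _ [u nu <-].
  rewrite lee_pdivrMr// muleC; apply/lee_addgt0Pr => eps eps0.
  have [w [nw wu]] :=
    nehari_above hN hf tau_orth tau_inv tau_nontrivial hV hV_tau hV_pos S0 nu eps0.
  by apply: le_trans wu; apply: ereal_inf_lbound; exists w.
have eq1 : nehari_level_tau tau f V = nehari_level_tau tau f (fun=> 0%R).
  by apply/eqP; rewrite eq_le le1 andbT (le_trans le3 le2).
have eq2 : nehari_level_tau tau f (fun=> 0%R) =
    (2%:E * nehari_level (N := N) f (fun=> 0%R))%E.
  by apply/eqP; rewrite eq_le le2 andbT -eq1.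
have not_attained : ~ (exists u : D12 R N,
    nehari_tau tau f V u /\ energy f V u = nehari_level_tau tau f V).
  move=> [u [nu uE]]; have [w [nw]] := below u nu.
  rewrite uE eq1 ltNge => /negP; apply.
  by apply: ereal_inf_lbound; exists w.
split => // -[u [u0 sol _ au uE]]; apply: not_attained; exists u; split => //.
split => //; split => //.
by rewrite -(sol u); apply: eq_integral => x _; rewrite expr2 mulrA.
Qed.
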